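(* Let $h$ be a positive definite form in $\mathcal{H}$ with associated operator $\mathbf{H}$, and let $\mathsf{R}(P)$ be a test subspace for $h$ with $\dim\mathsf{R}(P)=m$. If $\mu_m<\lambda_{m+1}$ and $\lambda_1=\lambda_m$, then for every unitary invariant norm $|||\cdot|||$ $$|||\,\mathrm{diag}(\eta_1^2,\dots,\eta_m^2)\,|||\le|||\,\mathbf{I}-\lambda_1\Xi^{-1}\,|||\le\frac{1}{\mathfrak{g}_1}\,|||\,\mathrm{diag}(\eta_1^2,\dots,\eta_m^2)\,|||$$ and $$\sum_{i=1}^m\eta_i^2\le\sum_{i=1}^m\frac{\mu_i-\lambda_i}{\mu_i}\le\frac{1}{\mathfrak{g}_1}\sum_{i=1}^m\eta_i^2.$$
   Context: $\mathcal{H}$ is an infinite dimensional (real or complex) Hilbert space with scalar product $(\cdot,\cdot)$ and norm $\|\cdot\|$. A positive definite form $h$ is a closed symmetric sesquilinear form with dense domain $\mathcal{Q}(h)\subset\mathcal{H}$ and strictly positive lower bound; write $h[u]=h(u,u)$. It defines (by the representation theorem for forms) a self-adjoint positive definite operator $\mathbf{H}$ with $\mathcal{D}(\mathbf{H}^{1/2})=\mathcal{Q}(h)$ and $h(u,v)=(\mathbf{H}^{1/2}u,\mathbf{H}^{1/2}v)$. The discrete eigenvalues of $\mathbf{H}$ below the infimum $\lambda_{ess}(\mathbf{H})$ of the essential spectrum are listed increasingly with multiplicity, $\lambda_1\le\lambda_2\le\dots<\lambda_{ess}(\mathbf{H})$; all $\lambda_i$ that occur are assumed to exist. A test subspace is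 the range $\mathsf{R}(P)$ of an orthogonal projection $P$ with $\dim\mathsf{R}(P)=m\in\mathbb{N}$ and $\mathsf{R}(P)\subset\mathcal{Q}(h)$; $P_\perp=\mathbf{I}-P$. The Rayleigh quotient is $\Xi=(\mathbf{H}^{1/2}P|_{\mathsf{R}(P)})^*\,\mathbf{H}^{1/2}P|_{\mathsf{R}(P)}$, an operator on $\mathsf{R}(P)$ with eigenvalues (Ritz values) $\mu_1\le\dots\le\mu_m$. $\mathbf{W}$ is the self-adjoint operator in $\mathsf{R}(P)^\perp$ defined by the form $h(P_\perp\cdot,P_\perp\cdot)$, and $\mathbf{H}_P$ is the self-adjoint operator in $\mathcal{H}$ defined by the form $h_P(u,v)=h(Pu,Pv)+h(P_\perp u,P_\perp v)$, $u,v\in\mathcal{Q}(h)$; thus $\mathbf{H}_P=\Xi\oplus\mathbf{W}$ with respect to $\mathcal{H}=\mathsf{R}(P)\oplus\mathsf{R}(P)^\perp$. For $i=1,\dots,m$, $$\eta_i:=\Big[\max_{\substack{\mathcal{S}\subset\mathsf{R}(P)\\ \dim\mathcal{S}=m-i+1}}\ \min_{\psi\in\mathcal{S},\,\|\psi\|=1}\frac{(\psi,\mathbf{H}^{-1}\psi)-(\psi,\mathbf{H}_P^{-1}\psi)}{(\psi,\mathbf{H}^{-1}\psi)}\Big]^{1/2},\qquad \mathfrak{g}_1:=\min\Big\{\frac{|\lambda_1-\mu|}{\mu}:\mu\in\Sigma(\mathbf{W})\Big\},$$ where $\Sigma(\mathbf{W})$ is the spectrum of $\mathbf{W}$. A unitary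 invariant norm $|||\cdot|||$ is a norm on an ideal $\mathcal{S}\subset\mathcal{L}(\mathcal{H})$ (the $|||\cdot|||$-closure of the finite rank operators, complete under $|||\cdot|||$) such that $|||ABC|||\le\|A\|\,|||B|||\,\|C\|$ for $B\in\mathcal{S}$, $A,C\in\mathcal{L}(\mathcal{H})$; $|||A|||=\|A\|$ for $A$ of rank one; $|||UAV|||=|||A|||$ for $A\in\mathcal{S}$ and $U,V$ unitary. Such a norm depends only on the singular values, and is therefore also applied to operators on $\mathsf{R}(P)$ and to $m\times m$ matrices. $\mathrm{diag}(\alpha_1,\dots,\alpha_m)$ is the diagonal matrix with the given entries. *)

(* Defs.v *)
From HB Require Import structures.
From mathcomp Require Export all_boot all_order all_algebra.
From mathcomp Require Export all_classical all_reals all_analysis.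
From mathcomp Require Export complex.

Set Implicit Arguments.
Unset Strict Implicit.
Unset Printing Implicit Defensive.

Export Order.TTheory GRing.Theory Num.Theory.
Export numFieldNormedType.Exports.

Local Open Scope classical_set_scope.
Local Open Scope ring_scope.

(* The scalar field of a Hilbert space is R or R[i]; inner products, norms and
   values of forms live in it, while eigenvalues, Ritz values and unitary
   invariant norms are elements of R.  [ofR] and [reK] go back and forth. *)
Inductive scalar_kind := RealScalars | ComplexScalars.

Definition scalars (R : realType) (k : scalar_kind) : numFieldType :=
  match k with
  | RealScalars => R
  | ComplexScalars => R[i]
  end.

Definition conjK (R : realType) (k : scalar_kind) :
    {rmorphism scalars R k -> scalars R k} :=
  match k with
  | RealScalars => (idfun : {rmorphism R -> R})
  | ComplexScalars => (Num.conj : {rmorphism R[i] -> R[i]})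
  end.

Definition ofR (R : realType) (k : scalar_kind) : R -> scalars R k :=
  match k with
  | RealScalars => fun x => x
  | ComplexScalars => fun x => x%:C%C
  end.

Definition reK (R : realType) (k : scalar_kind) : scalars R k -> R :=
  match k with
  | RealScalars => fun x => x
  | ComplexScalars => fun z => complex.Re z
  end.

(* The inner product is linear in its first argument. *)
Structure hilbertType (R : realType) (k : scalar_kind) := HilbertType {
  hilbert_sort :> completeNormedModType (scalars R k);
  inner : {dot hilbert_sort for @conjK R k};
  innerE : forall u : hilbert_sort, inner u u = `|u| ^+ 2
}.

Section Hilbert.
Variables (R : realType) (k : scalar_kind) (H : hilbertType R k).
Local Notation K := (scalars R k).
Local Notation "x %:K" := (ofR k x) (at level 2, format "x %:K").
Local Notation "''[' u , v ]" := (inner H u v).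

Definition lin_indep (n : nat) (b : 'I_n -> H) :=
  forall c : 'I_n -> K, \sum_i c i *: b i = 0 -> forall i, c i = 0.

(* [S] is a linear subspace of dimension [n]. *)
Definition has_dim (S : set H) (n : nat) := exists2 b : 'I_n -> H,
  lin_indep b & S = [set u | exists c : 'I_n -> K, u = \sum_i c i *: b i].

Definition infinite_dim := forall n, exists b : 'I_n -> H, lin_indep b.

Definition orthonormal_fam (n : nat) (e : 'I_n -> H) :=
  forall i j, '[e i, e j] = (i == j)%:R.

Definition orthocompl (M : set H) : set H :=
  [set u | forall v, M v -> '[u, v] = 0].

(* A sesquilinear form with domain [fdom]; the values of [fval] outside of
   [fdom] are irrelevant. *)
Record form := Form { fdom : set H; fval :> H -> H -> K }.

Record posdef_form (h : form) : Prop := {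
  fdom_subspace : fdom h 0 /\
    forall a u v, fdom h u -> fdom h v -> fdom h (a *: u + v);
  fdom_dense : dense (fdom h);
  form_linear : forall a u v w, fdom h u -> fdom h v -> fdom h w ->
    h (a *: u + v) w = a * h u w + h v w;
  form_symmetric : forall u v, fdom h u -> fdom h v -> h u v = conjK R k (h v u);
  form_lower_bound : exists2 c : K, 0 < c &
    forall u, fdom h u -> c * `|u| ^+ 2 <= h u u;
  form_closed : forall (x : nat -> H) (u : H), (forall n, fdom h (x n)) ->
    x @ \oo --> u ->
    (forall e : K, 0 < e -> exists N : nat, forall i j : nat,
      (N <= i)%N -> (N <= j)%N -> h (x i - x j) (x i - x j) < e) ->
    fdom h u /\ (fun n => h (x n - u) (x n - u)) @ \oo --> (0 : K)
}.

(* Unbounded operators are given by their graphs: [T u w] stands for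
   "u is in the domain of T and T u = w". *)
Definition operator := H -> H -> Prop.

Definition op_dom (T : operator) : set H := [set u | exists w, T u w].

Definition op_comp (S T : operator) : operator :=
  fun u w => exists2 v, T u v & S v w.

(* The preimage of [w]; it is the value at [w] of the inverse of [T] when [T]
   is injective and [w] is in its range. *)
Definition op_inv (T : operator) (w : H) : H := xget 0 [set u | T u w].

(* The operator associated, by the representation theorem, with the form [a]
   in the closed subspace [M]. *)
Definition form_op (M : set H) (a : form) : operator :=
  fun u w => [/\ fdom a u, M w & forall v, fdom a v -> a u v = '[w, v]].

(* The adjoint of [T], seen as an operator from [M] to [H]. *)
Definition op_adjoint (M : set H) (T : operator) : operator :=
  fun y x => M x /\ forall u w, T u w -> '[w, y] = '[u, x].

Definition selfadjoint (T : operator) :=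
  dense (op_dom T) /\ forall u w, T u w <-> op_adjoint setT T u w.

Definition nonneg_op (T : operator) := forall u w, T u w -> 0 <= '[w, u].

(* [S] is the square root of [T]. *)
Definition is_sqrt (T S : operator) :=
  [/\ selfadjoint S, nonneg_op S & forall u w, T u w <-> op_comp S S u w].

(* Spectral notions for an operator [T] in the closed subspace [M].  [z] is in
   the resolvent set when [T - z] is a bijection from the domain of [T] onto
   [M] with bounded inverse. *)
Definition resolvent_set (M : set H) (T : operator) : set K :=
  [set z | exists c : K, forall w, M w -> exists u,
     [/\ T u (w + z *: u), `|u| <= c * `|w| &
         forall v, T v (w + z *: v) -> v = u]].

Definition spectrum (M : set H) (T : operator) : set K :=
  ~` resolvent_set M T.

Definition eigenspace (T : operator) (z : K) : set H := [set u | T u (z *: u)].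

(* The isolated eigenvalues of finite multiplicity. *)
Definition discrete_spectrum (M : set H) (T : operator) : set K :=
  [set z | isolated (spectrum M T) z /\
     exists2 d, (0 < d)%N & has_dim (eigenspace T z) d].

Definition essential_spectrum (M : set H) (T : operator) : set K :=
  spectrum M T `\` discrete_spectrum M T.

Definition lambda_ess (T : operator) : \bar R :=
  ereal_inf [set x%:E | x in [set x : R | essential_spectrum setT T x%:K]].

(* [lam 0 <= ... <= lam n.-1] are the [n] lowest eigenvalues of [T], counted
   with multiplicity, and they are below the essential spectrum.  Only the
   last value may occur in the list less often than its multiplicity.
   Indices start at 0, so that the mathematical lambda_i is [lam i.-1]. *)
Definition lowest_eigenvalues (T : operator) (n : nat) (lam : nat -> R) :=
  [/\ forall i j : nat, (i <= j < n)%N -> lam i <= lam j,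
      forall i : nat, (i < n)%N -> ((lam i)%:E < lambda_ess T)%E &
      forall (x : R) (d : nat), has_dim (eigenspace T x%:K) d ->
        let mult := #|[set i : 'I_n | lam i == x]%SET| in
        (mult <= d)%N /\ ((exists2 i, (i < n)%N & x < lam i) -> mult = d)].

(* [mu 0 <= ... <= mu n.-1] are all the eigenvalues, counted with multiplicity,
   of a symmetric operator [T] on a space of dimension [n]. *)
Definition all_eigenvalues (T : operator) (n : nat) (mu : nat -> R) :=
  (forall i j : nat, (i <= j < n)%N -> mu i <= mu j) /\
  forall x : R, has_dim (eigenspace T x%:K) #|[set i : 'I_n | mu i == x]%SET|.

Definition orthoproj (P : {linear H -> H}) :=
  (forall u, P (P u) = P u) /\ forall u v, '[P u, v] = '[u, P v].

Definition test_subspace (h : form) (P : {linear H -> H}) (m : nat) :=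
  [/\ orthoproj P, has_dim (range P) m & range P `<=` fdom h].

(* The operator [S P] restricted to the range of [P], and the Rayleigh
   quotient [(S P)^* (S P)]; here [S] is the square root of H. *)
Definition sqrt_restr (S : operator) (P : {linear H -> H}) : operator :=
  fun u w => range P u /\ S (P u) w.

Definition rayleigh (S : operator) (P : {linear H -> H}) : operator :=
  op_comp (op_adjoint (range P) (sqrt_restr S P)) (sqrt_restr S P).

Definition form_W (h : form) (P : {linear H -> H}) : form :=
  Form (fdom h `&` orthocompl (range P))
       (fun u v => h (u - P u) (v - P v)).

Definition op_W (h : form) (P : {linear H -> H}) : operator :=
  form_op (orthocompl (range P)) (form_W h P).

Definition form_HP (h : form) (P : {linear H -> H}) : form :=
  Form (fdom h) (fun u v => h (P u) (P v) + h (u - P u) (v - P v)).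

Definition eta_quotient (h : form) (P : {linear H -> H}) (psi : H) : R :=
  let a := '[psi, op_inv (form_op setT h) psi] in
  let b := '[psi, op_inv (form_op setT (form_HP h P)) psi] in
  reK (a - b) / reK a.

(* [eta h P m i] is the mathematical eta_(i+1).  The inner infimum and the
   outer supremum are attained, by compactness. *)
Definition eta (h : form) (P : {linear H -> H}) (m i : nat) : R :=
  Num.sqrt (sup [set inf [set eta_quotient h P psi |
                            psi in [set psi | S psi /\ `|psi| = 1]] |
                 S in [set S | S `<=` range P /\ has_dim S (m - i)]]).

(* The spectrum of W is real, closed and nonempty, and the infimum is
   attained. *)
Definition gap1 (h : form) (P : {linear H -> H}) (lam1 : R) : R :=
  inf [set `|lam1 - x| / x |
       x in [set x : R | spectrum (orthocompl (range P)) (op_W h P) x%:K]].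

Definition bounded_op (A : H -> H) := linear A /\ continuous A.

Definition opnorm (A : H -> H) : R :=
  sup [set reK `|A u| | u in [set u : H | `|u| <= 1]].

Definition has_rank (n : nat) (A : H -> H) :=
  bounded_op A /\ has_dim (range A) n.

Definition unitary (U : H -> H) :=
  [/\ bounded_op U, range U = setT & forall u v, '[U u, U v] = '[u, v]].

Record unitary_inv_norm := UnitaryInvNorm {
  ui_ideal : set (H -> H);
  ui_norm :> (H -> H) -> R;
  ui_bounded : ui_ideal `<=` bounded_op;
  ui_linear : forall (a : K) A B, ui_ideal A -> ui_ideal B ->
    ui_ideal (fun u => a *: A u + B u);
  ui_mul : forall A B C, bounded_op A -> ui_ideal B -> bounded_op C ->
    ui_ideal (A \o B \o C);
  ui_finite_rank : forall n A, has_rank n A -> ui_ideal A;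
  ui_dense : forall A, ui_ideal A -> forall e : R, 0 < e ->
    exists2 F, (exists n, has_rank n F) & ui_norm (fun u => A u - F u) < e;
  ui_complete : forall A : nat -> H -> H, (forall n, ui_ideal (A n)) ->
    (forall e : R, 0 < e -> exists N : nat, forall i j : nat,
      (N <= i)%N -> (N <= j)%N -> ui_norm (fun u => A i u - A j u) < e) ->
    exists2 B, ui_ideal B &
      (fun n => ui_norm (fun u => A n u - B u)) @ \oo --> (0 : R);
  ui_ge0 : forall A, ui_ideal A -> 0 <= ui_norm A;
  ui_eq0 : forall A, ui_ideal A -> ui_norm A = 0 -> A = (fun=> 0);
  ui_triangle : forall A B, ui_ideal A -> ui_ideal B ->
    ui_norm (fun u => A u + B u) <= ui_norm A + ui_norm B;
  ui_scale : forall (a : K) A, ui_ideal A ->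
    ui_norm (fun u => a *: A u) = reK `|a| * ui_norm A;
  ui_norm_mul : forall A B C, bounded_op A -> ui_ideal B -> bounded_op C ->
    ui_norm (A \o B \o C) <= opnorm A * ui_norm B * opnorm C;
  ui_rank1 : forall A, has_rank 1 A -> ui_norm A = opnorm A;
  ui_unitary : forall U A V, unitary U -> ui_ideal A -> unitary V ->
    ui_norm (U \o A \o V) = ui_norm A
}.

(* The finite rank operator with matrix [A] on the span of the orthonormal
   family [e], vanishing on its orthogonal complement.  Its nonzero singular
   values are those of [A], so that the norm of [A] is, by definition, the norm
   of [mx_op e A], for any choice of [e]. *)
Definition mx_op (n : nat) (e : 'I_n -> H) (A : 'M[K]_n) : H -> H :=
  fun u => \sum_i (\sum_j A i j * '[u, e j]) *: e i.

Definition diag_eta2 (h : form) (P : {linear H -> H}) (m : nat) : 'M[K]_m :=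
  diag_mx (\row_(i < m) (eta h P m i ^+ 2)%:K).

(* [I - lam1 Xi^-1] on the range of [P], extended by zero on the orthogonal
   complement, which does not change its nonzero singular values. *)
Definition rayleigh_defect (S : operator) (P : {linear H -> H}) (lam1 : R) :
    H -> H :=
  fun u => P u - lam1%:K *: op_inv (rayleigh S P) (P u).

End Hilbert.

(* Main.v *)
(* Write [l] for the eigenvalue [lam 0 = ... = lam m.-1], [E] for its eigenspace,
   [G = H^-1] and [g = gap1 h P l].  Both claims follow from
     [g * (1 - l / mu_i) <= eta_i^2 <= 1 - l / mu_i],
   because [1 - l / mu_i] are the singular values of [I - l Xi^-1] and a unitary
   invariant norm is monotone in the singular values (compose with diagonal
   contractions).

   Upper bound: [G <= 1 / l], and every test space of dimension [m - i] meets the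
   span of the Ritz vectors [f_0, ..., f_i] (indices from 0), where
   [Xi^-1 >= 1 / mu_i].

   Lower bound: on the span of [f_i, ..., f_(m-1)] one needs [G] from below, and
   [(psi, G psi) >= 2 Re (psi, u) - h[u]] for every [u] in the form domain.  As
   [mu_(m-1) < lam_m], the projection [P] maps [E] onto its range, so each [phi]
   in the range is [P e] with [e] in [E].  With [v = e - phi], expanding [h]
   gives [h[phi] - l |phi|^2 = h[v] - l |v|^2 >= g h[v]], hence
   [h[phi + g v] <= (1 - g) h[phi] + g l |phi|^2].  This makes [G], compressed to
   the range of [P], at least [((1 - g) Xi + g l)^-1].

   The inequality [h[v] >= lam_m |v|^2] on the orthogonal complement of [E] is
   where the spectral hypotheses enter.  The supremum of [G] there is in the
   spectrum; were it above [1 / lam_m], it would be [1 / l], isolated in the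
   spectrum and not an eigenvalue of the restriction, which is impossible. *)
Require Import Defs.
From mathcomp Require Import ring lra.

Set Implicit Arguments.
Unset Strict Implicit.
Unset Printing Implicit Defensive.
Local Open Scope classical_set_scope.
Local Open Scope ring_scope.

(** * Scalars and real inner products *)

Section Scalars.
Variables (R : realType) (k : scalar_kind).
Local Notation K := (scalars R k).
Implicit Types (x y z : K) (a b : R).

Lemma reKD x y : reK (x + y) = reK x + reK y.
Proof. by case: k x y => //= -[? ?] [? ?]. Qed.

Lemma reKN x : reK (- x) = - reK x.
Proof. by case: k x => //= -[? ?]. Qed.

Lemma reKB x y : reK (x - y) = reK x - reK y.
Proof. by rewrite reKD reKN. Qed.

Lemma reK0 : reK (0 : K) = 0.
Proof. by case: k. Qed.

Lemma reK_sum I (r : seq I) (Q : pred I) (F : I -> K) :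
  reK (\sum_(i <- r | Q i) F i) = \sum_(i <- r | Q i) reK (F i).
Proof. exact: (big_morph _ reKD reK0). Qed.

Lemma ofRK a : reK (ofR k a) = a.
Proof. by case: k. Qed.

Lemma reK_ofRM a x : reK (ofR k a * x) = a * reK x.
Proof. by case: k x => //= -[? ?] /=; rewrite mul0r subr0. Qed.

Lemma reK_conj x : reK (conjK R k x) = reK x.
Proof. by case: k x => //= -[? ?]. Qed.

Lemma conj_conjK x : conjK R k (conjK R k x) = x.
Proof. by case: k x => //= x; rewrite conjCK. Qed.

Lemma conj_ofR a : conjK R k (ofR k a) = ofR k a.
Proof. by case: k => //=; exact: conjc_real. Qed.

Lemma ofR_inj : injective (ofR k : R -> K).
Proof. by move=> a b /(congr1 (@reK R k)); rewrite !ofRK. Qed.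

Lemma ofRD a b : ofR k (a + b) = ofR k a + ofR k b.
Proof. by case: k => //=; rewrite rmorphD. Qed.

Lemma ofRM a b : ofR k (a * b) = ofR k a * ofR k b.
Proof. by case: k => //=; rewrite rmorphM. Qed.

Lemma ofRN a : ofR k (- a) = - ofR k a.
Proof. by case: k => //=; rewrite rmorphN. Qed.

Lemma ofR0 : ofR k (0 : R) = 0. Proof. by case: k. Qed.

Lemma ofR1 : ofR k (1 : R) = 1. Proof. by case: k. Qed.

Lemma ler_ofR a b : (ofR k a <= ofR k b) = (a <= b).
Proof. by case: k => //=; rewrite lecR. Qed.

Lemma ltr_ofR a b : (ofR k a < ofR k b) = (a < b).
Proof. by case: k => //=; rewrite ltcR. Qed.

Lemma norm_ofR a : `|ofR k a| = ofR k `|a|.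
Proof. by case: k => //=; rewrite normc_def/= expr0n/= addr0 sqrtr_sqr. Qed.

Lemma ge0_ofRE x : 0 <= x -> x = ofR k (reK x).
Proof. by case: k x => [x|[a b]] //=; rewrite lecE/= => /andP[/eqP ->]. Qed.

Lemma mul_conjK x : x * conjK R k x = `|x| ^+ 2.
Proof. by case: k x => /= x; [rewrite -expr2 real_normK ?num_real|rewrite normCK]. Qed.

End Scalars.

(** The source of every Cauchy-Schwarz inequality below, for vectors, forms and semidefinite
    operators; in the last case [c] may vanish. *)
Lemma quadratic_discr (R : realType) (a b c : R) : 0 <= c ->
  (forall t, 0 <= a + 2 * t * b + t ^+ 2 * c) -> b ^+ 2 <= a * c.
Proof.
move=> c0 H; have [c_eq0|c_neq0] := eqVneq c 0.
  rewrite c_eq0 mulr0; have [->|b0] := eqVneq b 0; first by rewrite expr0n.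
  (* With [c = 0] the polynomial is affine in [t] and takes the value [-1] at this point. *)
  have := H (- (a + 1) / (2 * b)); rewrite c_eq0 mulr0 addr0.
  have -> : 2 * (- (a + 1) / (2 * b)) * b = - (a + 1) by field.
  lra.
have cp : 0 < c by rewrite lt_def c_neq0.
have := H (- b / c).
have -> : a + 2 * (- b / c) * b + (- b / c) ^+ 2 * c = (a * c - b ^+ 2) / c.
  by field.
by rewrite pmulr_lge0 ?invr_gt0// subr_ge0.
Qed.

Section RealInner.
Variables (R : realType) (k : scalar_kind) (H : hilbertType R k).
Local Notation K := (scalars R k).
Local Notation "''[' u , v ]" := (inner H u v).
Implicit Types (u v w x y : H) (a b : R).

Lemma innerC u v : '[u, v] = conjK R k '[v, u].
Proof. by rewrite hermC expr0 mul1r. Qed.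

Lemma innerZl (c : K) u v : '[c *: u, v] = c * '[u, v].
Proof. exact: linearZl_LR. Qed.

Lemma innerZr (c : K) u v : '[u, c *: v] = conjK R k c * '[u, v].
Proof. exact: linearZr_LR. Qed.

Lemma innerDl u v w : '[u + v, w] = '[u, w] + '[v, w].
Proof. exact: linearDl. Qed.

Lemma innerDr u v w : '[u, v + w] = '[u, v] + '[u, w].
Proof. exact: linearDr. Qed.

Lemma innerNl u v : '[- u, v] = - '[u, v].
Proof. exact: linearNl. Qed.

Lemma innerNr u v : '[u, - v] = - '[u, v].
Proof. exact: linearNr. Qed.

Lemma inner0l u : '[0, u] = 0. Proof. exact: linear0l. Qed.

Lemma inner0r u : '[u, 0] = 0. Proof. exact: linear0r. Qed.

Lemma inner_suml I (r : seq I) (Q : pred I) (F : I -> H) u :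
  '[\sum_(i <- r | Q i) F i, u] = \sum_(i <- r | Q i) '[F i, u].
Proof. by apply: (big_morph (fun x => '[x, u])) => [x y|]; rewrite ?innerDl ?inner0l. Qed.

Lemma inner_sumr I (r : seq I) (Q : pred I) (F : I -> H) u :
  '[u, \sum_(i <- r | Q i) F i] = \sum_(i <- r | Q i) '[u, F i].
Proof. by apply: (big_morph (fun x => '[u, x])) => [x y|]; rewrite ?innerDr ?inner0r. Qed.

(** The real inner product underlying a real or complex space. Estimates are made with it in [R],
    which treats both kinds of scalars at once. *)
Definition rdot u v : R := reK '[u, v].

Lemma rdotC u v : rdot u v = rdot v u.
Proof. by rewrite /rdot innerC reK_conj. Qed.

Lemma rdotDl u v w : rdot (u + v) w = rdot u w + rdot v w.
Proof. by rewrite /rdot innerDl reKD. Qed.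

Lemma rdotDr u v w : rdot u (v + w) = rdot u v + rdot u w.
Proof. by rewrite /rdot innerDr reKD. Qed.

Lemma rdotNl u v : rdot (- u) v = - rdot u v.
Proof. by rewrite /rdot innerNl reKN. Qed.

Lemma rdotNr u v : rdot u (- v) = - rdot u v.
Proof. by rewrite /rdot innerNr reKN. Qed.

Lemma rdotZl a u v : rdot (ofR k a *: u) v = a * rdot u v.
Proof. by rewrite /rdot innerZl reK_ofRM. Qed.

Lemma rdotZr a u v : rdot u (ofR k a *: v) = a * rdot u v.
Proof. by rewrite rdotC rdotZl rdotC. Qed.

Lemma rdot0l u : rdot 0 u = 0. Proof. by rewrite /rdot inner0l reK0. Qed.

Lemma rdot0r u : rdot u 0 = 0. Proof. by rewrite /rdot inner0r reK0. Qed.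

Definition rdotE := (rdotDl, rdotDr, rdotNl, rdotNr, rdotZl, rdotZr).

Lemma inner_selfE u : '[u, u] = ofR k (rdot u u).
Proof. by apply: ge0_ofRE; rewrite innerE exprn_ge0. Qed.

Lemma normr_sqrE u : `|u| ^+ 2 = ofR k (rdot u u).
Proof. by rewrite -innerE inner_selfE. Qed.

Lemma rdot_ge0 u : 0 <= rdot u u.
Proof. by rewrite -(ler_ofR k) ofR0 -normr_sqrE exprn_ge0. Qed.

Lemma rdot_eq0 u : rdot u u = 0 -> u = 0.
Proof.
by move=> h; apply/eqP; rewrite -normr_eq0 -sqrf_eq0 normr_sqrE h ofR0.
Qed.

Lemma rdot_gt0 u : u != 0 -> 0 < rdot u u.
Proof.
move=> u0; rewrite lt_def rdot_ge0 andbT; apply: contra u0 => /eqP h.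
by apply/eqP/rdot_eq0.
Qed.

Lemma normr_rdot u : `|u| = ofR k (Num.sqrt (rdot u u)).
Proof.
have n0 : 0 <= reK `|u| :> R by rewrite -(ler_ofR k) ofR0 -ge0_ofRE.
have -> : rdot u u = reK `|u| ^+ 2.
  by apply: (@ofR_inj _ k); rewrite -normr_sqrE expr2 ofRM -[ofR k _]ge0_ofRE.
by rewrite sqrtr_sqr ger0_norm// -ge0_ofRE.
Qed.

Lemma rdot_CS u v : rdot u v ^+ 2 <= rdot u u * rdot v v.
Proof.
apply: quadratic_discr => [|t]; first exact: rdot_ge0.
have := rdot_ge0 (u + ofR k t *: v); rewrite !rdotE (rdotC v u).
congr (_ <= _); ring.
Qed.

Lemma rdot_ext u v : (forall w, rdot u w = rdot v w) -> u = v.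
Proof.
move=> h; apply/eqP; rewrite -subr_eq0; apply/eqP/rdot_eq0.
by rewrite rdotDl rdotNl h subrr.
Qed.

Lemma reK_conjM0 (z : K) : reK (conjK R k z * z) = 0 -> z = 0.
Proof.
rewrite mulrC mul_conjK => h; apply/eqP.
rewrite -normr_eq0 -sqrf_eq0 (ge0_ofRE (exprn_ge0 2 (normr_ge0 z))).
by rewrite h ofR0.
Qed.

(** Taking for [c] the inner product itself turns the real part into a squared modulus. *)
Lemma rdot_inner_eq0 u v : (forall c : K, rdot u (c *: v) = 0) -> '[u, v] = 0.
Proof. by move=> /(_ '[u, v]); rewrite /rdot innerZr => /reK_conjM0. Qed.

Lemma ltr_normr_rdot u a : 0 < a -> (`|u| < ofR k a) = (rdot u u < a ^+ 2).
Proof.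
move=> a0; rewrite normr_rdot ltr_ofR.
by rewrite -{1}(ger0_norm (ltW a0)) -sqrtr_sqr ltr_sqrt// exprn_gt0.
Qed.

Lemma cvg_rdotP (x : nat -> H) u : x @ \oo --> u <->
  forall e : R, 0 < e -> exists N : nat, forall n, (N <= n)%N ->
    rdot (x n - u) (x n - u) < e.
Proof.
split=> [xu e e0|xu].
  have se : 0 < Num.sqrt e by rewrite sqrtr_gt0.
  move/cvgrPdist_lt: xu => /(_ (ofR k (Num.sqrt e))).
  rewrite -{1}(ofR0 R k) ltr_ofR => /(_ se)[N _ hN]; exists N => n nN.
  have := hN n nN; rewrite /= distrC ltr_normr_rdot// sqr_sqrtr//; exact: ltW.
apply/cvgrPdist_lt => e e0; rewrite (ge0_ofRE (ltW e0)).
have e0' : 0 < reK e by rewrite -(ltr_ofR k) ofR0 -ge0_ofRE// ltW.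
have [N hN] := xu (reK e ^+ 2) (exprn_gt0 _ e0').
by exists N => // n /= /hN; rewrite distrC ltr_normr_rdot.
Qed.

Lemma hilbert_complete (x : nat -> H) :
  (forall e : R, 0 < e -> exists N : nat, forall i j : nat,
    (N <= i)%N -> (N <= j)%N -> rdot (x i - x j) (x i - x j) < e) ->
  exists u, x @ \oo --> u.
Proof.
move=> xc; suff : cvg (x @ \oo) by move=> h; exists (lim (x @ \oo)).
apply: cauchy_cvg; apply: cauchy_exP => e e0.
have e0' : 0 < reK e by rewrite -(ltr_ofR k) ofR0 -ge0_ofRE// ltW.
have [N hN] := xc (reK e ^+ 2) (exprn_gt0 _ e0').
exists (x N); exists N => // n /= Nn.
rewrite -ball_normE /ball_/= (ge0_ofRE (ltW e0)) ltr_normr_rdot//.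
exact: hN.
Qed.

End RealInner.

(** * Closed forms and their inverses *)

(** If [a > 0], then [e = 1] forces [C > 0], and [e = a / (2 C)] gives a contradiction. This
    replaces passages to the limit below. *)
Lemma le0_eps (R : realType) (a C : R) : (forall e : R, 0 < e -> a <= e * C) -> a <= 0.
Proof.
move=> h; rewrite leNgt; apply/negP => a0.
have C0 : 0 < C by have := h 1 ltr01; rewrite mul1r; exact: lt_le_trans.
have := h (a / (2 * C)) (divr_gt0 a0 (mulr_gt0 (ltr0n R 2) C0)).
have -> : a / (2 * C) * C = a / 2 by field; rewrite gt_eqF.
lra.
Qed.

Section Subspaces.
Variables (R : realType) (k : scalar_kind) (H : hilbertType R k).
Local Notation K := (scalars R k).

Definition subspace (D : set H) :=
  D 0 /\ forall (a : K) u v, D u -> D v -> D (a *: u + v).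

Variables (D : set H) (Dsub : subspace D).

Lemma subspaceD u v : D u -> D v -> D (u + v).
Proof. by move=> Du Dv; rewrite -[u]scale1r; apply: Dsub.2. Qed.

Lemma subspaceZ (a : K) u : D u -> D (a *: u).
Proof. by move=> Du; rewrite -[_ *: _]addr0; apply: Dsub.2 => //; exact: Dsub.1. Qed.

Lemma subspaceN u : D u -> D (- u).
Proof. by rewrite -scaleN1r; exact: subspaceZ. Qed.

Lemma subspaceB u v : D u -> D v -> D (u - v).
Proof. by move=> Du Dv; apply: subspaceD => //; exact: subspaceN. Qed.

Lemma subspace_sum I (r : seq I) (Q : pred I) (F : I -> H) :
  (forall i, Q i -> D (F i)) -> D (\sum_(i <- r | Q i) F i).
Proof.
move=> DF; elim/big_ind : _ => //; first exact: Dsub.1.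
exact: subspaceD.
Qed.

End Subspaces.

Ltac in_subspace := by repeat first
  [ assumption | apply: subspaceB | apply: subspaceD | apply: subspaceN
  | apply: subspaceZ ].

Section Forms.
Variables (R : realType) (k : scalar_kind) (H : hilbertType R k).
Variables (h : form H) (hpd : posdef_form h).
Local Notation K := (scalars R k).
Local Notation Q := (fdom h).
Implicit Types (u v w x y : H) (a b : R).

Definition hr u v : R := reK (h u v).

Let Qsub : subspace Q := fdom_subspace hpd.

Lemma formDl u v w : Q u -> Q v -> Q w -> h (u + v) w = h u w + h v w.
Proof.
by move=> Qu Qv Qw; rewrite -{1}[u]scale1r (form_linear hpd)// mul1r.
Qed.

Lemma form0l w : Q w -> h 0 w = 0.
Proof.
by move=> Qw; apply: (addIr (h 0 w)); rewrite -formDl ?addr0 ?add0r//; exact: Qsub.1.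
Qed.

Lemma formZl (a : K) u w : Q u -> Q w -> h (a *: u) w = a * h u w.
Proof.
move=> Qu Qw; rewrite -[a *: u]addr0 (form_linear hpd)//; last exact: Qsub.1.
by rewrite form0l// addr0.
Qed.

Lemma hrC u v : Q u -> Q v -> hr u v = hr v u.
Proof. by move=> Qu Qv; rewrite /hr (form_symmetric hpd)// reK_conj. Qed.

Lemma hrDl u v w : Q u -> Q v -> Q w -> hr (u + v) w = hr u w + hr v w.
Proof. by move=> *; rewrite /hr formDl// reKD. Qed.

Lemma hrZl a u w : Q u -> Q w -> hr (ofR k a *: u) w = a * hr u w.
Proof. by move=> *; rewrite /hr formZl// reK_ofRM. Qed.

Lemma hrNl u w : Q u -> Q w -> hr (- u) w = - hr u w.
Proof. by move=> *; rewrite /hr -scaleN1r formZl// mulN1r reKN. Qed.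

Lemma hrBl u v w : Q u -> Q v -> Q w -> hr (u - v) w = hr u w - hr v w.
Proof. by move=> Qu Qv Qw; rewrite hrDl ?hrNl//; in_subspace. Qed.

Lemma hrDr u v w : Q u -> Q v -> Q w -> hr w (u + v) = hr w u + hr w v.
Proof. by move=> *; rewrite !(hrC (u := w)) ?hrDl//; in_subspace. Qed.

Lemma hrZr a u w : Q u -> Q w -> hr w (ofR k a *: u) = a * hr w u.
Proof. by move=> *; rewrite !(hrC (u := w)) ?hrZl//; in_subspace. Qed.

Lemma hrBr u v w : Q u -> Q v -> Q w -> hr w (u - v) = hr w u - hr w v.
Proof. by move=> *; rewrite !(hrC (u := w)) ?hrBl//; in_subspace. Qed.

Lemma hr_expand t u v : Q u -> Q v ->
  hr (u + ofR k t *: v) (u + ofR k t *: v) = hr u u + 2 * t * hr u v + t ^+ 2 * hr v v.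
Proof.
move=> Qu Qv; have Qtv : Q (ofR k t *: v) by in_subspace.
rewrite hrDl ?hrDr ?hrZl ?hrZr//; try in_subspace.
rewrite (hrC Qv Qu); ring.
Qed.

Lemma hrB_expand u v : Q u -> Q v ->
  hr (u - v) (u - v) = hr u u - 2 * hr u v + hr v v.
Proof.
move=> Qu Qv; have := hr_expand (-1) Qu Qv.
rewrite ofRN ofR1 scaleN1r => ->; ring.
Qed.

Lemma hr_lower_bound : exists2 c : R, 0 < c &
  forall u, Q u -> c * rdot u u <= hr u u.
Proof.
have [c c0 hc] := form_lower_bound hpd.
have c0' : 0 < reK c by rewrite -(ltr_ofR k) ofR0 -ge0_ofRE// ltW.
exists (reK c) => // u /hc; rewrite normr_sqrE {1}(ge0_ofRE (ltW c0)) -ofRM => hu.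
rewrite -(ler_ofR k) (le_trans hu)// /hr -ge0_ofRE//.
by apply: le_trans hu; rewrite -(ofR0 R k) ler_ofR mulr_ge0 ?rdot_ge0// ltW.
Qed.

Lemma hr_ge0 u : Q u -> 0 <= hr u u.
Proof.
have [c c0 hc] := hr_lower_bound => /hc; apply: le_trans.
by rewrite mulr_ge0 ?rdot_ge0// ltW.
Qed.

Lemma form_selfE u : Q u -> h u u = ofR k (hr u u).
Proof.
move=> Qu; apply: ge0_ofRE; have [c c0 /(_ u Qu)] := form_lower_bound hpd.
by apply: le_trans; rewrite mulr_ge0 ?exprn_ge0// ltW.
Qed.

Lemma hr_eq0 u : Q u -> hr u u <= 0 -> u = 0.
Proof.
move=> Qu hu; have [c c0 hc] := hr_lower_bound; apply: rdot_eq0.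
have : c * rdot u u <= 0 by exact: le_trans (hc _ Qu) hu.
by rewrite pmulr_rle0// => h1; apply/eqP; rewrite eq_le h1 rdot_ge0.
Qed.

Lemma hr_CS u v : Q u -> Q v -> hr u v ^+ 2 <= hr u u * hr v v.
Proof.
move=> Qu Qv; apply: quadratic_discr => [|t]; first exact: hr_ge0.
by rewrite -hr_expand//; apply: hr_ge0; in_subspace.
Qed.

Lemma hr_closed (x : nat -> H) u : (forall n, Q (x n)) -> x @ \oo --> u ->
  (forall e : R, 0 < e -> exists N : nat, forall i j : nat,
    (N <= i)%N -> (N <= j)%N -> hr (x i - x j) (x i - x j) < e) ->
  Q u /\ forall e : R, 0 < e -> exists N : nat, forall n, (N <= n)%N ->
    hr (x n - u) (x n - u) < e.
Proof.
move=> Qx xu xc; have [|Qu hxu] := form_closed hpd Qx xu.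
  move=> e e0; have e0' : 0 < reK e by rewrite -(ltr_ofR k) ofR0 -ge0_ofRE// ltW.
  have [N hN] := xc _ e0'; exists N => i j Ni Nj.
  have Qij : Q (x i - x j) by apply: (subspaceB Qsub).
  by rewrite (form_selfE Qij) (ge0_ofRE (ltW e0)) ltr_ofR hN.
split=> // e e0; move/cvgrPdist_lt : hxu => /(_ (ofR k e)).
rewrite -{1}(ofR0 R k) ltr_ofR => /(_ e0)[N _ hN]; exists N => n nN.
have Qn : Q (x n - u) by apply: (subspaceB Qsub).
have := hN n nN; rewrite /= sub0r normrN form_selfE// norm_ofR ltr_ofR.
exact: le_lt_trans (ler_norm _).
Qed.

(** Tested at [c *: v] with [c = h u v - (w, v)], the real identity becomes [|c|^2 = 0]. *)
Lemma hr_all_eq0 (D : set H) u w : subspace D -> D `<=` Q -> Q u ->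
  (forall v, D v -> hr u v = rdot w v) -> forall v, D v -> h u v = inner H w v.
Proof.
move=> Dsub DQ Qu huw v Dv; apply/eqP; rewrite -subr_eq0; apply/eqP.
apply: reK_conjM0; set c := (X in conjK _ _ X).
have := huw (c *: v) (subspaceZ Dsub _ Dv).
rewrite /rdot innerZr /hr (form_symmetric hpd)//; last by apply: DQ; exact: subspaceZ.
rewrite formZl//; last exact: DQ.
rewrite rmorphM -(form_symmetric hpd)//; last exact: DQ.
by move=> e; rewrite mulrBr reKB e subrr.
Qed.

End Forms.

Lemma natr_inv_lt (R : realType) (e : R) : 0 < e ->
  exists N : nat, forall n, (N <= n)%N -> n.+1%:R^-1 < e.
Proof.
move=> e0; exists (Num.truncn e^-1) => n Nn.
rewrite invf_plt ?posrE// (lt_le_trans (truncnS_gt _))// ler_nat ltnS//.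
Qed.

Lemma sqr_le_square_sum3 (R : realType) (a b c : R) :
  (a + b + c) ^+ 2 <= 3 * (a ^+ 2 + b ^+ 2 + c ^+ 2).
Proof.
have := sqr_ge0 (a - b); have := sqr_ge0 (b - c); have := sqr_ge0 (a - c).
by rewrite !sqrrD; lra.
Qed.

(** * Minimization of quadratic functionals on a subspace *)

Section Minimization.
Variables (R : realType) (k : scalar_kind) (H : hilbertType R k).
Variables (h : form H) (hpd : posdef_form h).
Local Notation K := (scalars R k).
Local Notation Q := (fdom h).

(* The Euler-Lagrange equation of [h[v] - x |v|^2 - 2 F v] on [D]; [D] need not
   be closed, so that the minimizer only lies in its closure for [h]. *)
Lemma form_minimizer (D : set H) (F : H -> R) (x c B : R) :
  subspace D -> D `<=` Q -> 0 < c ->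
  (forall v, D v -> c * rdot v v <= hr h v v - x * rdot v v) ->
  (forall u v, D u -> D v -> F (u + v) = F u + F v) ->
  (forall t v, D v -> F (ofR k t *: v) = t * F v) ->
  (forall v, D v -> - B <= hr h v v - x * rdot v v - 2 * F v) ->
  exists u, [/\ Q u,
    forall e : R, 0 < e -> exists2 v, D v & hr h (v - u) (v - u) < e &
    forall v, D v -> hr h u v - x * rdot u v = F v].
Proof.
move=> Ds DQ c0 hc FD FZ hB.
have Qs : subspace Q := fdom_subspace hpd.
pose q u v := hr h u v - x * rdot u v.
pose J v := q v v - 2 * F v.
have q_expand t u v : D u -> D v ->
    q (u + ofR k t *: v) (u + ofR k t *: v) = q u u + 2 * t * q u v + t ^+ 2 * q v v.
  move=> Du Dv; rewrite /q (hr_expand hpd)//; try exact: DQ.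
  rewrite !rdotE (rdotC v u); ring.
have J_expand t u v : D u -> D v ->
    J (u + ofR k t *: v) = J u + 2 * t * (q u v - F v) + t ^+ 2 * q v v.
  move=> Du Dv; rewrite /J q_expand// FD ?FZ//; first by ring.
  exact: subspaceZ.
have qC u v : D u -> D v -> q u v = q v u.
  by move=> Du Dv; rewrite /q (hrC hpd) 1?rdotC//; exact: DQ.
have q_ge0 v : D v -> 0 <= q v v.
  by move=> Dv; apply: le_trans (hc v Dv); rewrite mulr_ge0 ?rdot_ge0// ltW.
pose E := [set J v | v in D].
have E0 : E !=set0 by exists (J 0); exists 0 => //; exact: Ds.1.
have Elb : has_lbound E by exists (- B) => _ [v Dv <-]; exact: hB.
pose A := inf E.
have JA v : D v -> A <= J v by move=> Dv; apply: ge_inf => //; exists v.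
have /choice[vn vnP] : forall n : nat, exists v, D v /\ J v < A + n.+1%:R^-1.
  move=> n; have n0 : 0 < n.+1%:R^-1 :> R by rewrite invr_gt0 ltr0n.
  by have [_ [v Dv <-] hv] := inf_adherent n0 (conj E0 Elb); exists v.
have Dvn n : D (vn n) by case: (vnP n).
have Jvn n : J (vn n) < A + n.+1%:R^-1 by case: (vnP n).
(* The midpoint of [v] and [w] also satisfies [J >= A], so almost minimizers are close to each
   other. *)
have parallelogram v w : D v -> D w -> q (v - w) (v - w) <= 2 * (J v - A) + 2 * (J w - A).
  move=> Dv Dw.
  have Dm : D (w + ofR k (2^-1) *: (v - w)) by in_subspace.
  have := JA _ Dm; rewrite J_expand//; last by in_subspace.
  have := J_expand 1 w (v - w) Dw; rewrite ofR1 scale1r subrKC => /(_ _)->; last first.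
    by in_subspace.
  move=> ?; lra.
(* Coercivity absorbs the term [x |v|^2], so that a Cauchy sequence for [q] is one for [h]. *)
pose M := 1 + `|x| / c.
have M0 : 0 < M by rewrite ltr_pwDl ?divr_ge0// ltW.
have hr_q v : D v -> hr h v v <= M * q v v.
  move=> Dv; have -> : hr h v v = q v v + x * rdot v v by rewrite /q subrK.
  rewrite mulrDl mul1r lerD2l mulrAC ler_pdivlMr//.
  rewrite (le_trans (ler_wpM2r (ltW c0) (ler_wpM2r (rdot_ge0 v) (ler_norm x))))//.
  by rewrite -mulrA ler_wpM2l// mulrC; exact: hc.
have q_cauchy (e : R) : 0 < e -> exists N : nat, forall i j : nat,
    (N <= i)%N -> (N <= j)%N -> q (vn i - vn j) (vn i - vn j) < e.
  move=> e0; have [N hN] := natr_inv_lt (divr_gt0 e0 (ltr0n R 4)).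
  exists N => i j Ni Nj; apply: le_lt_trans (parallelogram _ _ (Dvn i) (Dvn j)) _.
  have := hN _ Ni; have := hN _ Nj; have := Jvn i; have := Jvn j.
  move: (J _) (J _) j.+1%:R^-1 i.+1%:R^-1 => *; lra.
have [u vnu] : exists u : H, (vn : nat -> H) @ \oo --> u.
  apply: hilbert_complete => e e0; have [N hN] := q_cauchy _ (mulr_gt0 c0 e0).
  exists N => i j Ni Nj; rewrite -(ltr_pM2l c0); apply: le_lt_trans (hN i j Ni Nj).
  by apply: hc; apply: subspaceB.
have [||Qu hvnu] := hr_closed hpd (x := vn) _ vnu.
- by move=> n; exact: DQ.
- move=> e e0; have [N hN] := q_cauchy _ (divr_gt0 e0 M0).
  exists N => i j Ni Nj; apply: le_lt_trans (hr_q _ _) _; first exact: subspaceB.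
  by rewrite mulrC -ltr_pdivlMr//; exact: hN.
exists u; split => // [e e0|v Dv].
  by have [N hN] := hvnu e e0; exists (vn N) => //; exact: hN.
apply/eqP; rewrite -subr_eq0 -sqrf_eq0 eq_le sqr_ge0 andbT -/(q u v).
have Qv := DQ _ Dv.
apply: (@le0_eps _ _ (3 * (q v v + hr h v v + x ^+ 2 * rdot v v))) => e e0.
have [N1 hN1] := natr_inv_lt e0; have [N2 hN2] := hvnu e e0.
move/cvg_rdotP : (vnu) => /(_ e e0)[N3 hN3].
pose n := maxn N1 (maxn N2 N3); pose w := vn n.
have Qw : Q w by apply: DQ; exact: Dvn.
have en : n.+1%:R^-1 < e by apply: hN1; rewrite leq_maxl.
have hn : hr h (w - u) (w - u) < e by apply: hN2; rewrite !leq_max leqnn orbT.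
have rn : rdot (w - u) (w - u) < e by apply: hN3; rewrite !leq_max leqnn !orbT.
(* The residual at [u] is the residual at the almost minimizer [w] plus two errors that vanish with
   [w - u]. *)
have -> : q u v - F v = (q w v - F v) + (- hr h (w - u) v) + x * rdot (w - u) v.
  by rewrite /q (hrBl hpd)// !rdotE; ring.
apply: le_trans (sqr_le_square_sum3 _ _ _) _.
rewrite (mulrC e) -mulrA ler_pM2l// (mulrDl (q v v + hr h v v)) (mulrDl (q v v)).
rewrite sqrrN; apply: lerD; first apply: lerD.
- apply: le_trans (_ : n.+1%:R^-1 * q v v <= _); last first.
    by rewrite mulrC ler_wpM2l ?q_ge0// ltW.
  (* For all [t], [J (w + t v) >= A > J w - 1 / (n + 1)]; the discriminant of this inequality in [t]
     bounds the residual at [w]. *)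
  apply: quadratic_discr => [|t]; first exact: q_ge0.
  have Dn : D (vn n + ofR k t *: v) by in_subspace.
  have := JA _ Dn; rewrite J_expand// -/w; have := Jvn n; rewrite -/w.
  by move: (J w) n.+1%:R^-1 => ? ? ? ?; lra.
- apply: le_trans (hr_CS hpd _ Qv) _; first by in_subspace.
  by rewrite mulrC ler_wpM2l ?(hr_ge0 hpd)// ltW.
- rewrite exprMn -mulrA ler_wpM2l ?sqr_ge0//.
  apply: le_trans (rdot_CS _ _) _.
  by rewrite mulrC ler_wpM2l ?rdot_ge0// ltW.
Qed.

End Minimization.

(** * Orthogonal projection *)

Section Projection.
Variables (R : realType) (k : scalar_kind) (H : hilbertType R k).
Local Notation K := (scalars R k).
Local Notation "''[' u , v ]" := (inner H u v).

(** The inner product as an everywhere defined form makes orthogonal projection a special case of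
    [form_minimizer]. *)
Definition inner_form : form H := Form setT (inner H).

Lemma inner_form_posdef : posdef_form inner_form.
Proof.
split => //=.
- by move=> O O0 _; rewrite setIT.
- by move=> a u v w _ _ _; rewrite innerDl innerZl.
- by move=> u v _ _; exact: innerC.
- by exists 1 => // u _; rewrite mul1r innerE.
move=> x u _ xu _; split => //; apply/cvgrPdist_lt => e e0.
move/cvg_rdotP : xu => /(_ (reK e)); rewrite -(ltr_ofR k) ofR0 -ge0_ofRE 1?ltW//.
move=> /(_ e0)[N hN]; exists N => // n /= /hN.
rewrite sub0r normrN inner_selfE norm_ofR ger0_norm ?rdot_ge0//.
by rewrite {2}(ge0_ofRE (ltW e0)) ltr_ofR.
Qed.

Lemma rdot_all_inner_eq0 (D : set H) u : subspace D ->
  (forall v, D v -> rdot u v = 0) -> forall v, D v -> '[u, v] = 0.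
Proof. by move=> Ds h v Dv; apply: rdot_inner_eq0 => c; apply: h; exact: subspaceZ. Qed.

(** Minimize [|v|^2 - 2 Re (u, v)]. As [D] need not be closed, [p] is only known to be a limit of
    vectors of [D]. *)
Lemma projection_exists (D : set H) : subspace D -> forall u, exists p,
  (forall e : R, 0 < e -> exists2 v, D v & rdot (v - p) (v - p) < e) /\
  forall v, D v -> '[u - p, v] = 0.
Proof.
move=> Ds u.
have [||v _|v w _ _|t v _|v _|p [_ pcl hp]] := form_minimizer inner_form_posdef
    (D := D) (F := rdot u) (x := 0) (c := 1) (B := rdot u u) Ds.
- by [].
- exact: ltr01.
- by rewrite mul1r mul0r subr0.
- exact: rdotDr.
- exact: rdotZr.
- have := rdot_ge0 (v - u); rewrite !rdotE mul0r subr0 (rdotC v u) /hr/= -/(rdot v v).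
  lra.
exists p; split => //; apply: rdot_all_inner_eq0 => // v Dv.
by rewrite !rdotE -(hp v Dv) mul0r subr0 subrr.
Qed.

Lemma orthocompl_subspace (M : set H) : subspace (orthocompl M).
Proof.
split=> [v _|a u v hu hv w Mw]; first exact: inner0l.
by rewrite innerDl innerZl hu// hv// mulr0 addr0.
Qed.

Lemma rdot_closure_eq0 (D : set H) u w :
  (forall e : R, 0 < e -> exists2 v, D v & rdot (v - u) (v - u) < e) ->
  (forall v, D v -> rdot v w = 0) -> rdot u w = 0.
Proof.
move=> hu hw; apply/eqP; rewrite -sqrf_eq0 eq_le sqr_ge0 andbT.
apply: (@le0_eps _ _ (rdot w w)) => e /hu[v Dv hv].
have -> : rdot u w = - rdot (v - u) w by rewrite rdotDl rdotNl (hw v Dv) sub0r opprK.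
by rewrite sqrrN (le_trans (rdot_CS _ _))// ler_wpM2r ?rdot_ge0// ltW.
Qed.

Lemma orthocompl_closed (M D : set H) u :
  (forall e : R, 0 < e -> exists2 v, D v & rdot (v - u) (v - u) < e) ->
  D `<=` orthocompl M -> orthocompl M u.
Proof.
move=> hu DM w Mw; apply: rdot_inner_eq0 => c; apply: (rdot_closure_eq0 hu) => v Dv.
by rewrite /rdot innerZr (DM v Dv w Mw) mulr0 reK0.
Qed.

End Projection.

(** * The bounded inverse of the operator of a form *)

Section Inverse.
Variables (R : realType) (k : scalar_kind) (H : hilbertType R k).
Variables (h : form H) (hpd : posdef_form h).
Local Notation K := (scalars R k).
Local Notation Q := (fdom h).
Local Notation "''[' u , v ]" := (inner H u v).
Let Qsub : subspace Q := fdom_subspace hpd.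

Lemma form_approx_rdot (D : set H) u :
  (D `<=` Q) -> Q u ->
  (forall e : R, 0 < e -> exists2 v, D v & hr h (v - u) (v - u) < e) ->
  forall e : R, 0 < e -> exists2 v, D v & rdot (v - u) (v - u) < e.
Proof.
move=> DQ Qu hu e e0; have [c c0 hc] := hr_lower_bound hpd.
have [v Dv hv] := hu _ (mulr_gt0 c0 e0); exists v => //.
rewrite -(ltr_pM2l c0); apply: le_lt_trans hv; apply: hc.
by apply: (subspaceB Qsub) => //; exact: DQ.
Qed.

(** The weak form of [(T - x) u = w] on [D] is the Euler-Lagrange equation in [form_minimizer] for
    the functional [rdot w]. *)
Lemma shifted_form_solve (D : set H) (x c : R) (w : H) :
  subspace D -> D `<=` Q -> 0 < c ->
  (forall v, D v -> c * rdot v v <= hr h v v - x * rdot v v) ->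
  exists u, [/\ Q u,
    forall e : R, 0 < e -> exists2 v, D v & rdot (v - u) (v - u) < e &
    forall v, D v -> hr h u v - x * rdot u v = rdot w v].
Proof.
move=> Ds DQ c0 hc.
have [u v _ _|t v _|v Dv|u [Qu ucl hu]] := form_minimizer hpd
    (F := rdot w) (B := rdot w w / c) Ds DQ c0 hc.
- exact: rdotDr.
- exact: rdotZr.
(* Completing the square bounds the quadratic functional below by [- |w|^2 / c]. *)
- have := hc v Dv; have := rdot_ge0 (ofR k c *: v - w).
  rewrite !rdotE (rdotC v w) => h1 h2.
  have : 0 <= rdot w w / c - 2 * rdot w v + c * rdot v v.
    rewrite -(pmulr_rge0 _ c0); apply: le_trans h1 _; rewrite le_eqVlt.
    by apply/orP; left; apply/eqP; field; rewrite gt_eqF.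
  by move: h2; lra.
by exists u; split => //; exact: form_approx_rdot ucl.
Qed.

(** The inverse [H^-1], written [G]; most spectral arguments concern it rather than the unbounded
    operator. *)
Definition form_inv (w : H) : H := op_inv (form_op setT h) w.
Local Notation G := form_inv.

Lemma form_op_uniq (M : set H) u v w :
  form_op M h u w -> form_op M h v w -> u = v.
Proof.
move=> [Qu _ hu] [Qv _ hv]; apply/eqP; rewrite -subr_eq0; apply/eqP.
have Quv : Q (u - v) by in_subspace.
by apply: (hr_eq0 hpd) => //; rewrite (hrBl hpd)// /hr hu// hv// subrr.
Qed.

Lemma form_invP w : form_op setT h (G w) w.
Proof.
have [c c0 hc] := hr_lower_bound hpd.
have [||u [Qu _ hu]] := shifted_form_solve (D := Q) (x := 0) w Qsub _ c0.
- by [].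
- by move=> v /hc; rewrite mul0r subr0.
have uw : form_op setT h u w.
  split => //; apply: (hr_all_eq0 hpd) => // v /hu.
  by rewrite mul0r subr0.
by rewrite /form_inv /op_inv; case: xgetP => [v ->//|/(_ u)].
Qed.

Lemma form_inv_dom w : Q (G w). Proof. by case: (form_invP w). Qed.

Lemma form_invE w v : Q v -> h (G w) v = '[w, v].
Proof. by case: (form_invP w) => _ _; apply. Qed.

Lemma hr_form_inv w v : Q v -> hr h (G w) v = rdot w v.
Proof. by move=> Qv; rewrite /hr form_invE. Qed.

Lemma form_opE u w : form_op setT h u w <-> u = G w.
Proof.
split=> [uw|->]; last exact: form_invP.
exact: form_op_uniq uw (form_invP w).
Qed.

Lemma form_inv_linear : linear G.
Proof.
move=> a u v; apply/esym/form_opE; have := Qsub.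
have QG := form_inv_dom; split => //; first by in_subspace.
move=> w Qw; rewrite (formDl hpd)//; last by in_subspace.
by rewrite (formZl hpd)// !form_invE// innerDl innerZl.
Qed.

Lemma form_invZ (a : K) u : G (a *: u) = a *: G u.
Proof.
have G0 : G 0 = 0.
  have := form_inv_linear (-1) 0 0; rewrite scaler0 add0r scaleN1r addNr//.
by rewrite -[a *: u]addr0 form_inv_linear G0 addr0.
Qed.

Lemma form_invD u v : G (u + v) = G u + G v.
Proof. by rewrite -[u]scale1r form_inv_linear !scale1r. Qed.

Lemma form_invB u v : G (u - v) = G u - G v.
Proof. by rewrite form_invD -scaleN1r form_invZ scaleN1r. Qed.

Lemma form_inv_sym u v : '[G u, v] = '[u, G v].
Proof.
rewrite innerC -form_invE; last exact: form_inv_dom.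
by rewrite -(form_symmetric hpd) ?form_invE//; exact: form_inv_dom.
Qed.

Lemma rdot_form_inv_sym u v : rdot (G u) v = rdot u (G v).
Proof. by rewrite /rdot form_inv_sym. Qed.

Lemma rdot_form_inv_hr u : rdot (G u) u = hr h (G u) (G u).
Proof. by rewrite hr_form_inv 1?rdotC//; exact: form_inv_dom. Qed.

(** Expand [h[G u - v] >= 0]. Every trial vector [v] thus gives a lower bound for [(G u, u)]. *)
Lemma rdot_form_inv_ge u v : Q v -> 2 * rdot u v - hr h v v <= rdot (G u) u.
Proof.
move=> Qv; have QG := form_inv_dom u.
have : 0 <= hr h (G u - v) (G u - v) by apply: (hr_ge0 hpd); in_subspace.
rewrite (hrB_expand hpd)// -rdot_form_inv_hr hr_form_inv//; lra.
Qed.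

(** With [q = (G u, u) = h[G u]], one has [c q^2 <= c |G u|^2 |u|^2 <= q |u|^2]. *)
Lemma form_inv_le c : 0 <= c -> (forall u, Q u -> c * rdot u u <= hr h u u) ->
  forall u, c * rdot (G u) u <= rdot u u.
Proof.
move=> c0 hc u; have h1 := hc _ (form_inv_dom u).
rewrite -rdot_form_inv_hr in h1; have h2 := rdot_CS (G u) u.
have [q0|q0] := leP (rdot (G u) u) 0.
  by rewrite (le_trans _ (rdot_ge0 u))// mulr_ge0_le0.
rewrite -(ler_pM2l q0) mulrCA -expr2.
apply: le_trans (ler_wpM2l c0 h2) _.
by rewrite mulrA ler_wpM2r ?rdot_ge0.
Qed.

(** The operator domain is a core of the form: the [h]-projection [p] of [u] on the range of [G]
    satisfies [|p - u|^2 = h(G (p - u), p - u) = 0]. *)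
Lemma form_inv_range_dense u : Q u -> forall e : R, 0 < e ->
  exists w, hr h (G w - u) (G w - u) < e.
Proof.
move=> Qu.
have Ds : subspace (range G).
  split; first by exists 0 => //; rewrite -[RHS](scale0r (G 0)) -form_invZ scale0r.
  move=> a _ _ [x _ <-] [y _ <-]; exists (a *: x + y) => //.
  exact: form_inv_linear.
have DQ : range G `<=` Q by move=> _ [w _ <-]; exact: form_inv_dom.
have [c c0 hc] := hr_lower_bound hpd.
have [v Dv|v w Dv Dw|t v Dv|v Dv|p [Qp pcl hp]] := form_minimizer hpd
    (F := hr h u) (B := hr h u u) (x := 0) Ds DQ c0.
- by rewrite mul0r subr0; exact/hc/DQ.
- by rewrite (hrDr hpd)//; exact: DQ.
- by rewrite (hrZr hpd)//; exact: DQ.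
- have Qv := DQ _ Dv; have : 0 <= hr h (u - v) (u - v).
    by apply: (hr_ge0 hpd); in_subspace.
  rewrite (hrB_expand hpd)// mul0r; lra.
have <- : p = u.
  apply/eqP; rewrite -subr_eq0; apply/eqP; apply: rdot_eq0.
  have Qpu : Q (p - u) by in_subspace.
  rewrite -hr_form_inv// (hrC hpd)//; last exact: form_inv_dom.
  have /hp : range G (G (p - u)) by exists (p - u).
  rewrite (hrBl hpd)//; last exact: form_inv_dom.
  by rewrite mul0r subr0 => ->; rewrite subrr.
by move=> e /pcl[_ [w _ <-] hw]; exists w.
Qed.

End Inverse.

(** * Isolated points of the spectrum *)

Section PositiveOperators.
Variables (R : realType) (k : scalar_kind) (H : hilbertType R k).
Local Notation K := (scalars R k).

(** Linearity and symmetry are required on the whole space, the bounds on [V] only: [V] will be the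
    orthogonal complement of an eigenspace. *)
Record positive_on (V : set H) (A : H -> H) (M : R) : Prop := {
  pos_add : forall u v, A (u + v) = A u + A v;
  pos_scale : forall (t : K) u, A (t *: u) = t *: A u;
  pos_stable : forall u, V u -> V (A u);
  pos_sym : forall u v, rdot (A u) v = rdot u (A v);
  pos_bound_ge0 : 0 <= M;
  pos_ge0 : forall u, V u -> 0 <= rdot (A u) u;
  pos_le : forall u, V u -> rdot (A u) u <= M * rdot u u
}.

Variable V : set H.
Hypothesis Vsub : subspace V.

(** Cauchy-Schwarz for the semidefinite form [(A ., .)], applied to [v] and [A v]. *)
Lemma pos_CS A M v : positive_on V A M -> V v ->
  rdot (A v) (A v) ^+ 2 <= rdot (A v) v * rdot (A (A v)) (A v).
Proof.
move=> pA Vv; have VA := pos_stable pA Vv.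
apply: quadratic_discr => [|t]; first exact: (pos_ge0 pA).
have : 0 <= rdot (A (v + ofR k t *: A v)) (v + ofR k t *: A v).
  by apply: (pos_ge0 pA); in_subspace.
rewrite (pos_add pA) (pos_scale pA) !rdotE (pos_sym pA (A v) v).
congr (_ <= _); ring.
Qed.

(** This is [A^2 <= M A]: in [pos_CS], bound the last factor by [M |A v|^2] and cancel [|A v|^2]. *)
Lemma pos_sqr_le A M v : positive_on V A M -> V v ->
  rdot (A v) (A v) <= M * rdot (A v) v.
Proof.
move=> pA Vv; have VA := pos_stable pA Vv.
have q0 := pos_ge0 pA Vv; have M0 := pos_bound_ge0 pA.
have [->|n0] := eqVneq (rdot (A v) (A v)) 0; first exact: mulr_ge0.
have n_gt0 : 0 < rdot (A v) (A v) by rewrite lt_def n0 rdot_ge0.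
rewrite -(ler_pM2r n_gt0) -expr2; apply: le_trans (pos_CS pA Vv) _.
by rewrite [M * _]mulrC -mulrA ler_wpM2l// (pos_le pA).
Qed.

Lemma pos_shift_sqr A M c v : positive_on V A M -> V v ->
  rdot (A v - ofR k c *: v) (A v - ofR k c *: v) =
  rdot (A v) (A v) - 2 * c * rdot (A v) v + c ^+ 2 * rdot v v.
Proof. by move=> pA Vv; rewrite !rdotE (rdotC v (A v)); ring. Qed.

Variables (B : H -> H) (M d : R).
Hypotheses (pB : positive_on V B M) (d0 : 0 < d).
Hypothesis B_shift_bounded_below : forall s : R, 0 < s < d -> exists2 c : R, 0 < c &
  forall u, c * rdot u u <= rdot (B u - ofR k s *: u) (B u - ofR k s *: u).

(* If the lower bound [r] of [(B - d/2)^2] on [V] were smaller than [d^2/4],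
   then one of [d/2 - sqrt r] and [d/2 + sqrt r] would be an approximate
   eigenvalue of [B] in [(0, d)]. *)
Lemma pos_gap_sqr v : V v -> d * rdot (B v) v <= rdot (B v) (B v).
Proof.
pose c := d / 2; have c0 : 0 < c by rewrite divr_gt0.
pose C v := B v - ofR k c *: v.
pose S := [set r : R | 0 <= r <= c ^+ 2 /\
  forall v, V v -> r * rdot v v <= rdot (C v) (C v)].
have S0 : S 0 by split => [|w _]; rewrite ?lexx ?sqr_ge0 ?mul0r ?rdot_ge0.
have Sub : has_ubound S by exists (c ^+ 2) => r [/andP[]].
have Ssup : has_sup S by split => //; exists 0.
pose r := sup S.
have r0 : 0 <= r by apply: ub_le_sup.
have rc : r <= c ^+ 2 by apply: ge_sup; [exists 0|move=> s [/andP[]]].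
have rP w : V w -> r * rdot w w <= rdot (C w) (C w).
  move=> Vw; have [->|n0] := eqVneq (rdot w w) 0; first by rewrite mulr0 rdot_ge0.
  have w0 : 0 < rdot w w by rewrite lt_def n0 rdot_ge0.
  rewrite -ler_pdivlMr//; apply: ge_sup; first by exists 0.
  by move=> s [_ /(_ w Vw)]; rewrite ler_pdivlMr.
suff rE : r = c ^+ 2.
  move=> Vv; have := rP v Vv; rewrite (pos_shift_sqr c pB Vv) rE.
  have -> : d = 2 * c by rewrite /c; field.
  lra.
apply/eqP; rewrite eq_le rc/= leNgt; apply/negP => rlt.
pose r' := Num.sqrt r.
have r'E : r' ^+ 2 = r by rewrite sqr_sqrtr.
have r'0 : 0 <= r' by exact: sqrtr_ge0.
have r'c : r' < c by rewrite -ltr_sqr ?nnegrE ?(ltW c0)// r'E.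
pose A w := C (C w) - ofR k r *: w.
have CD x y : C (x + y) = C x + C y.
  by rewrite /C (pos_add pB) scalerDr opprD addrACA.
have CZ t x : C (t *: x) = t *: C x.
  by rewrite /C (pos_scale pB) scalerBr !scalerA mulrC.
have CV x : V x -> V (C x).
  by move=> Vx; have VBx := pos_stable pB Vx; rewrite /C; in_subspace.
have Csym x y : rdot (C x) y = rdot x (C y).
  by rewrite /C !rdotE (pos_sym pB).
have M0 := pos_bound_ge0 pB.
pose N := 2 * M ^+ 2 + 2 * c ^+ 2.
have N0 : 0 <= N by rewrite addr_ge0// mulr_ge0// sqr_ge0.
have pA : positive_on V A N.
  split => //.
  - by move=> x y; rewrite /A !CD scalerDr opprD addrACA.
  - by move=> t x; rewrite /A !CZ [in RHS]scalerBr !scalerA (mulrC t).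
  - by move=> x Vx; have := CV _ (CV _ Vx); rewrite /A => ?; in_subspace.
  - by move=> x y; rewrite /A rdotDl rdotNl rdotZl rdotDr rdotNr rdotZr !Csym.
  - move=> x Vx; rewrite /A rdotDl rdotNl rdotZl Csym.
    by have := rP x Vx; lra.
  move=> x Vx; rewrite /A rdotDl rdotNl rdotZl Csym.
  have h1 := mulr_ge0 r0 (rdot_ge0 x); rewrite (pos_shift_sqr c pB Vx).
  have h2 := pos_sqr_le pB Vx; have h3 := ler_wpM2l M0 (pos_le pB Vx).
  have h4 := mulr_ge0 (ltW c0) (pos_ge0 pB Vx).
  have h5 := mulr_ge0 (sqr_ge0 M) (rdot_ge0 x).
  have h6 := mulr_ge0 (sqr_ge0 c) (rdot_ge0 x).
  rewrite /N; move: h1 h2 h3 h4 h5 h6; lra.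
(* Both [c + r'] and [c - r'] lie in [(0, d)], where the hypothesis on [B] applies. *)
have [c1 c1_gt0 hc1] : exists2 c1 : R, 0 < c1 & forall u,
    c1 * rdot u u <= rdot (B u - ofR k (c + r') *: u) (B u - ofR k (c + r') *: u).
  by apply: B_shift_bounded_below; move: r'c r'0 c0; rewrite /c; lra.
have [c2 c2_gt0 hc2] : exists2 c2 : R, 0 < c2 & forall u,
    c2 * rdot u u <= rdot (B u - ofR k (c - r') *: u) (B u - ofR k (c - r') *: u).
  by apply: B_shift_bounded_below; move: r'c r'0 c0; rewrite /c; lra.
(* A difference of squares: [A = (B - c)^2 - r'^2]. *)
have A_fact x : let y := B x - ofR k (c - r') *: x in
    A x = B y - ofR k (c + r') *: y.
  have BB x1 x2 : B (x1 - x2) = B x1 - B x2.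
    by rewrite (pos_add pB) -scaleN1r (pos_scale pB) scaleN1r.
  by apply: rdot_ext => w; rewrite /A /C -r'E !BB !(pos_scale pB) !rdotE; ring.
(* The first bound keeps [r + e] at most [c^2], as membership in [S] demands; the second makes
   [N * e < c1 * c2], which contradicts the lower bounds at a vector [w] nearly attaining [r]. *)
pose e := Num.min (c ^+ 2 - r) (c1 * c2 / (2 * (N + 1))).
have N1 : 0 < 2 * (N + 1) by rewrite mulr_gt0 ?ltr_wpDl.
have e0 : 0 < e.
  by rewrite lt_min subr_gt0 rlt; apply: divr_gt0 => //; exact: mulr_gt0.
have [w Vw hw] : exists2 w, V w & rdot (C w) (C w) < (r + e) * rdot w w.
  apply: contrapT => hno; suff : r + e <= r by rewrite gerDl leNgt e0.
  apply: ub_le_sup => //; split => [|w Vw].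
    by rewrite addr_ge0 ?(ltW e0)//= -lerBrDl ge_min lexx.
  by rewrite leNgt; apply/negP => h; apply: hno; exists w.
have w0 : 0 < rdot w w.
  rewrite lt_def rdot_ge0 andbT; apply: contraTneq hw => ->.
  by rewrite mulr0 -leNgt rdot_ge0.
have h1 : c1 * c2 * rdot w w <= rdot (A w) (A w).
  rewrite A_fact -mulrA; apply: le_trans (hc1 _); rewrite ler_pM2l//; exact: hc2.
have h2 := pos_sqr_le pA Vw.
have h3 : rdot (A w) w <= e * rdot w w.
  rewrite /A rdotDl rdotNl rdotZl Csym; move: hw; lra.
have : c1 * c2 <= N * e.
  rewrite -(ler_pM2r w0); apply: le_trans h1 _; apply: le_trans h2 _.
  by rewrite -mulrA ler_wpM2l.
apply/negP; rewrite -ltNge.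
apply: le_lt_trans (_ : N * (c1 * c2 / (2 * (N + 1))) < _).
  by rewrite ler_wpM2l// ge_min lexx orbT.
rewrite mulrA ltr_pdivrMr// mulrC ltr_pM2l ?mulr_gt0//; move: N0; lra.
Qed.

(** Insert [d (B v, v) <= |B v|^2] in [|B v|^4 <= (B v, v) (B (B v), B v)] and cancel [|B v|^2]. *)
Lemma pos_gap_range v : V v -> d * rdot (B v) (B v) <= rdot (B (B v)) (B v).
Proof.
move=> Vv; have VB := pos_stable pB Vv.
have [->|n0] := eqVneq (rdot (B v) (B v)) 0.
  by rewrite mulr0; exact: (pos_ge0 pB).
have n_gt0 : 0 < rdot (B v) (B v) by rewrite lt_def n0 rdot_ge0.
rewrite -(ler_pM2r n_gt0) -mulrA -expr2.
apply: le_trans (ler_wpM2l (ltW d0) (pos_CS pB Vv)) _.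
rewrite mulrA mulrC ler_wpM2l ?(pos_ge0 pB)//; exact: pos_gap_sqr.
Qed.

(* [(B v, v) >= d |v|^2] holds on the range of [B], which is dense in [V] since
   [B] is symmetric and injective on [V]. *)
Lemma pos_gap (W : set H) : V = orthocompl W ->
  (forall v, V v -> B v = 0 -> v = 0) ->
  forall v, V v -> d / 4 * rdot v v <= rdot (B v) v.
Proof.
move=> VW kerB v Vv.
have Ds : subspace (B @` V).
  split.
    by exists 0; [exact: Vsub.1|rewrite -[RHS](scale0r (B 0)) -(pos_scale pB) scale0r].
  move=> a _ _ [x Vx <-] [y Vy <-]; exists (a *: x + y); first exact: Vsub.2.
  by rewrite (pos_add pB) (pos_scale pB).
have DV : B @` V `<=` V by move=> _ [x Vx <-]; exact: (pos_stable pB).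
have [p [pcl hp]] := projection_exists Ds v.
(* An orthogonal complement is closed, so [V] contains the limit [p]. *)
have Vp : V p by rewrite VW; apply: orthocompl_closed pcl _; rewrite -VW.
have Vvp : V (v - p) by in_subspace.
(* By choice of [p], [v - p] is orthogonal to [B (v - p)]; conclude by [B^2 <= M B]. *)
have : B (v - p) = 0.
  apply: rdot_eq0; apply/eqP; rewrite eq_le rdot_ge0 andbT.
  apply: le_trans (pos_sqr_le pB Vvp) _.
  by rewrite rdotC /rdot hp ?reK0 ?mulr0//; exists (v - p).
move=> /(kerB _ Vvp)/eqP; rewrite subr_eq0 => /eqP vp; move: pcl; rewrite -{}vp => vcl.
rewrite -subr_le0; apply: (@le0_eps _ _ (M + d)) => e e0.
have [_ [x Vx <-] hx] := vcl e e0.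
have VBx := pos_stable pB Vx.
have h1 := pos_gap_range Vx.
have Vd : V (B x - v) by in_subspace.
have Vd2 : V (B x - v - v) by in_subspace.
(* With [y = B x] close to [v], these give [|v|^2 <= 2 |y|^2 + 2 |y - v|^2] and
   [(B y, y) <= 2 (B v, v) + 2 M |y - v|^2]. The two factors [2] explain [d / 4]. *)
have h2 := pos_ge0 pB Vd2; have h3 := rdot_ge0 (B x - v + B x).
have h4 := pos_le pB Vd; have M0 := pos_bound_ge0 pB.
have h5 := ler_wpM2l M0 (ltW hx); have h6 := ler_wpM2l (ltW d0) (ltW hx).
have h7 := ler_wpM2l (ltW d0) h3.
move: h1 h2 h4 h5 h6 h7; set y := B x.
have BN u : B (- u) = - B u by rewrite -scaleN1r (pos_scale pB) scaleN1r.
rewrite !(pos_add pB) !BN !rdotE (rdotC v y).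
have -> : rdot (B v) y = rdot (B y) v by rewrite (pos_sym pB) rdotC.
have := mulr_ge0 (ltW d0) (ltW e0); lra.
Qed.

End PositiveOperators.

Lemma ler_reK (R : realType) (k : scalar_kind) (x y : scalars R k) :
  x <= y -> reK x <= reK y.
Proof.
case: k x y => [x y //|x y]; rewrite lecE => /andP[_].
by case: x y => [? ?] [? ?].
Qed.

Section SpectralGap.
Variables (R : realType) (k : scalar_kind) (H : hilbertType R k).
Variables (h : form H) (hpd : posdef_form h).
Local Notation K := (scalars R k).
Local Notation Q := (fdom h).
Local Notation "''[' u , v ]" := (inner H u v).
Local Notation T := (form_op setT h).
Local Notation G := (form_inv h).
Let Qsub : subspace Q := fdom_subspace hpd.

Lemma eigenspaceP (z : K) u : eigenspace T z u <-> u = z *: G u.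
Proof. by rewrite -(form_invZ hpd); exact: form_opE. Qed.

Lemma eigenspace_subspace (z : K) : subspace (eigenspace T z).
Proof.
split=> [|a u v]; rewrite !eigenspaceP.
  by rewrite -(form_invZ hpd) scaler0 -[X in G X](scale0r 0) (form_invZ hpd) scale0r.
move=> Eu Ev; rewrite (form_inv_linear hpd) scalerDr scalerA mulrC -scalerA.
by rewrite -Eu -Ev.
Qed.

(** Let [y = (G - 1/x) u]. The resolvent sends [u - x G u = - x y] to [G u], so [y] controls [G u],
    and therefore [u = x (G u - y)]. *)
Lemma resolvent_bounded_below (x : R) : 0 < x ->
  resolvent_set setT T (ofR k x) -> exists2 c : R, 0 < c & forall u,
    c * rdot u u <= rdot (G u - ofR k x^-1 *: u) (G u - ofR k x^-1 *: u).
Proof.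
move=> x0 [C hC]; pose D := reK C ^+ 2 * x ^+ 2; have D0 : 0 <= D.
  by rewrite mulr_ge0 ?sqr_ge0.
have E0 : 0 < 2 * x ^+ 2 * (D + 1).
  by rewrite !mulr_gt0// ?exprn_gt0// ltr_wpDl.
exists (2 * x ^+ 2 * (D + 1))^-1; first by rewrite invr_gt0.
move=> u; set y := G u - _.
have xK : ofR k x *: y = ofR k x *: G u - u.
  by rewrite /y scalerBr scalerA -ofRM divff ?ofR1 ?scale1r// gt_eqF.
have [//|v [Tv nv huniq]] := hC (u - ofR k x *: G u).
have Gv : v = G u by apply/esym/huniq; rewrite subrK; exact: form_invP.
rewrite Gv !normr_rdot in nv; move: nv => /ler_reK.
rewrite ofRK mulrC reK_ofRM => nv.
have h1 : rdot (G u) (G u) <= D * rdot y y.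
  rewrite -[leLHS]sqr_sqrtr ?rdot_ge0//.
  have -> : D * rdot y y =
      (Num.sqrt (rdot (u - ofR k x *: G u) (u - ofR k x *: G u)) * reK C) ^+ 2.
    rewrite exprMn sqr_sqrtr ?rdot_ge0// -[u - _]opprB -xK.
    by rewrite rdotNl rdotNr opprK rdotZl rdotZr /D; ring.
  rewrite ler_sqr ?nnegrE ?sqrtr_ge0//; exact: le_trans (sqrtr_ge0 _) nv.
rewrite mulrC ler_pdivrMr//.
have -> : rdot u u = x ^+ 2 * rdot (G u - y) (G u - y).
  have -> : G u - y = ofR k x^-1 *: u by rewrite /y opprB addrC subrK.
  by rewrite rdotZl rdotZr; field; rewrite gt_eqF.
have h2 : rdot (G u - y) (G u - y) <= 2 * (D + 1) * rdot y y.
  clear -h1; clearbody y; have := rdot_ge0 (G u + y); rewrite !rdotE (rdotC y (G u)); lra.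
have -> : rdot y y * (2 * x ^+ 2 * (D + 1)) = x ^+ 2 * (2 * (D + 1) * rdot y y) by ring.
by rewrite ler_pM2l ?exprn_gt0.
Qed.

(** Shifting [1/x - G] by [s] corresponds to the point [1 / (1/x - s)] above [x], which is outside
    the spectrum for small [s]. *)
Lemma isolated_bounded_below (x : R) : 0 < x -> isolated (spectrum setT T) (ofR k x) ->
  exists2 d : R, 0 < d & forall s : R, 0 < s < d -> exists2 c : R, 0 < c & forall u,
    c * rdot u u <= rdot ((ofR k x^-1 *: u - G u) - ofR k s *: u)
                         ((ofR k x^-1 *: u - G u) - ofR k s *: u).
Proof.
move=> x0 [_ [V nV VE]].
have [e /= e0 he] : exists2 e : K, 0 < e & ball (ofR k x) e `<=` V.
  by move/nbhs_ballP : nV => [e e0 he]; exists e.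
have e0' : 0 < reK e by rewrite -(ltr_ofR k) ofR0 -ge0_ofRE// ltW.
have g0 : 0 < x^-1 by rewrite invr_gt0.
(* The first bound gives [1/x - s > 1 / (2 x)]; the second then puts [1 / (1/x - s)] within [e] of
   [x]. *)
exists (Num.min (x^-1 / 2) (reK e * x ^- 2 / 2)).
  by rewrite lt_min !divr_gt0// ?mulr_gt0 ?invr_gt0 ?exprn_gt0.
move=> s /andP[s0]; rewrite lt_min => /andP[s1 s2].
have gs : 0 < x^-1 - s by move: g0 s1; lra.
have yx : (x^-1 - s)^-1 - x = s / (x^-1 * (x^-1 - s)).
  have xn : x != 0 by rewrite gt_eqF.
  have xs : 1 + - s * x != 0.
    have -> : 1 + - s * x = x * (x^-1 - s) by field.
    by rewrite mulf_neq0// gt_eqF.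
  by field; rewrite xn xs.
have yx0 : 0 < (x^-1 - s)^-1 - x by rewrite yx divr_gt0 ?mulr_gt0.
have [||c c0 hc] := @resolvent_bounded_below (x^-1 - s)^-1; first by rewrite invr_gt0.
  apply: contrapT => hs.
  have : (V `&` spectrum setT T) (ofR k (x^-1 - s)^-1).
    split => //; apply: he; rewrite -ball_normE /ball_/=.
    rewrite -ofRN -ofRD norm_ofR (ge0_ofRE (ltW e0)) ltr_ofR distrC gtr0_norm//.
    rewrite yx ltr_pdivrMr ?mulr_gt0//.
    apply: lt_le_trans s2 _; rewrite -mulrA ler_pM2l// -exprVn expr2 -mulrA ler_pM2l//.
    by move: s1; lra.
  rewrite VE => /ofR_inj /eqP; rewrite -subr_eq0 => /eqP yx1.
  by rewrite yx1 ltxx in yx0.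
rewrite invrK in hc; exists c => // u; apply: le_trans (hc u) _.
rewrite le_eqVlt; apply/orP; left; apply/eqP.
have -> : G u - ofR k (x^-1 - s) *: u = - (ofR k x^-1 *: u - G u - ofR k s *: u).
  by apply: rdot_ext => w; rewrite !rdotE; ring.
by rewrite rdotNl rdotNr opprK.
Qed.

End SpectralGap.

(** * The spectrum below [lam m] and the gap above the lowest eigenvalue *)

Section LowestEigenvalues.
Variables (R : realType) (k : scalar_kind) (H : hilbertType R k).
Variables (h : form H) (hpd : posdef_form h).
Local Notation K := (scalars R k).
Local Notation Q := (fdom h).
Local Notation "''[' u , v ]" := (inner H u v).
Local Notation T := (form_op setT h).
Local Notation G := (form_inv h).
Let Qsub : subspace Q := fdom_subspace hpd.

Variables (m : nat) (m_gt0 : (0 < m)%N) (lam : nat -> R).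
Hypotheses (lamE : lowest_eigenvalues T m.+1 lam) (lam1m : lam 0%N = lam m.-1).
Local Notation l := (lam 0%N).
Local Notation E := (eigenspace T (ofR k l)).

Lemma lam_eq i : (i < m)%N -> lam i = l.
Proof.
move=> im; apply/eqP; rewrite eq_le; case: lamE => mono _ _.
have im1 : (i <= m.-1)%N by rewrite -ltnS prednK.
apply/andP; split; last by apply: mono; rewrite leq0n ltnW.
by rewrite lam1m; apply: mono; rewrite im1 ltnS leq_pred.
Qed.

Lemma lam_le : l <= lam m.
Proof. by case: lamE => mono _ _; apply: mono; rewrite leq0n/=. Qed.

Lemma below_ess_discrete (T' : operator H) (x : R) : ((x%:E < lambda_ess T')%E) ->
  spectrum setT T' (ofR k x) -> discrete_spectrum setT T' (ofR k x).
Proof.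
move=> xess sx; apply: contrapT => nd; move: xess; rewrite ltNge => /negP; apply.
by apply: ereal_inf_lbound; exists x.
Qed.

Lemma has_dim_neq0 (S : set H) d : (0 < d)%N -> has_dim S d -> exists2 u, S u & u != 0.
Proof.
move=> d0 [b bfree ->]; pose i0 := Ordinal d0.
exists (b i0).
  exists (fun i => (i == i0)%:R); rewrite (bigD1 i0)//= ?eqxx scale1r big1 ?addr0//.
  by move=> i /negPf->; rewrite scale0r.
apply: contraT; rewrite negbK => /eqP b0.
have := bfree (fun i => (i == i0)%:R).
rewrite (bigD1 i0)//= b0 scaler0 add0r big1 => [|i /negPf->]; last by rewrite scale0r.
by move=> /(_ erefl i0); rewrite eqxx => /eqP; rewrite oner_eq0.
Qed.

Lemma eigenspace_resolvent (x : R) : resolvent_set setT T (ofR k x) ->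
  has_dim (eigenspace T (ofR k x)) 0.
Proof.
move=> [C hC]; exists (fun=> 0) => [c _ []//|].
have [//|u [_ _ huniq]] := hC 0.
have E0 v : eigenspace T (ofR k x) v -> v = u.
  by move=> Ev; apply: huniq; rewrite add0r.
apply/seteqP; split=> v /=.
  move=> /E0 ->; exists (fun=> 0); rewrite big_ord0.
  by apply/esym/E0; exact: (eigenspace_subspace hpd _).1.
by case=> c; rewrite big_ord0 => ->; exact: (eigenspace_subspace hpd _).1.
Qed.

(** At a resolvent point the eigenspace has dimension [0], whereas [l] occurs at least once in the
    list. *)
Lemma lowest_in_spectrum : spectrum setT T (ofR k l).
Proof.
move=> /eigenspace_resolvent /(let: And3 _ _ h := lamE in h _ _)[+ _].
by rewrite leqn0 cards_eq0 => /eqP/setP/(_ ord0); rewrite !inE eqxx.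
Qed.

Lemma lowest_discrete : discrete_spectrum setT T (ofR k l).
Proof.
apply: below_ess_discrete lowest_in_spectrum; case: lamE => _ + _; exact.
Qed.

Lemma eigenvalue_gt0 (x : R) u : eigenspace T (ofR k x) u -> u != 0 -> 0 < x.
Proof.
move=> Eu u0; have [Qu _ hu] := Eu.
have [c c0 hc] := hr_lower_bound hpd.
have := hc u Qu; rewrite /hr hu// innerZl reK_ofRM -/(rdot u u) => h1.
rewrite (lt_le_trans c0)// -(ler_pM2r (rdot_gt0 u0))//.
Qed.

Lemma lam_gt0 : 0 < l.
Proof.
have [_ [d d0 /(has_dim_neq0 d0)[u Eu u0]]] := lowest_discrete.
exact: eigenvalue_gt0 Eu u0.
Qed.

(** Multiplicities are exact for values below some entry of the list, here [lam m]. An eigenvalue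
    below [lam m] is therefore listed, at an index below [m]. *)
Lemma spectrum_below_lam (x : R) : x < lam m -> spectrum setT T (ofR k x) ->
  x = l /\ isolated (spectrum setT T) (ofR k l).
Proof.
move=> xlt sx; have [_ hess hmult] := lamE.
have xess : (x%:E < lambda_ess T)%E.
  by apply: lt_trans (hess m (ltnSn m)); rewrite lte_fin.
have [iso [d d0 hd]] := below_ess_discrete xess sx.
have [_ md] := hmult x d hd.
have := md (ex_intro2 _ _ m (ltnSn m) xlt) => mult_d.
have : (0 < #|[set i : 'I_m.+1 | lam i == x]%SET|)%N by rewrite mult_d.
move=> /card_gt0P[i +]; rewrite inE => /eqP lix.
have im : (i < m)%N.
  have := ltn_ord i; rewrite ltnS leq_eqVlt => /orP[/eqP im|//].
  by move: xlt; rewrite -lix im ltxx.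
by rewrite -(lam_eq im) lix.
Qed.

Lemma orthocompl_eigen_stable u : orthocompl E u -> orthocompl E (G u).
Proof.
move=> Vu e Ee; have /eigenspaceP Ge := Ee.
have G_e : G e = ofR k l^-1 *: e.
  by rewrite [in RHS](Ge hpd) scalerA -ofRM mulVf ?gt_eqF ?lam_gt0// ofR1 scale1r.
by rewrite (form_inv_sym hpd) G_e innerZr Vu// mulr0.
Qed.

Lemma spectral_gap v : orthocompl E v -> lam m * rdot (G v) v <= rdot v v.
Proof.
pose V := orthocompl E; have Vs : subspace V by exact: orthocompl_subspace.
have l0 := lam_gt0; have L0 : 0 < lam m := lt_le_trans l0 lam_le.
pose S := [set r : R | 0 <= r /\ forall v, V v -> rdot (G v) v <= r * rdot v v].
have [C C0 /(form_inv_le hpd (ltW C0)) hC] := hr_lower_bound hpd.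
have S0 : has_inf S.
  split; last by exists 0 => r [].
  by exists C^-1; split => [|u _]; rewrite ?invr_ge0 ?(ltW C0)// ler_pdivlMl.
(* The least nonnegative upper bound of [G] on [V]. *)
pose g := inf S.
have gP w : V w -> rdot (G w) w <= g * rdot w w.
  move=> Vw; have [w0|n0] := eqVneq (rdot w w) 0.
    by rewrite (rdot_eq0 w0) !rdot0r mulr0.
  have w0 : 0 < rdot w w by rewrite lt_def n0 rdot_ge0.
  rewrite -ler_pdivrMr//; apply: lb_le_inf; first by case: S0.
  by move=> r [_ /(_ w Vw)]; rewrite ler_pdivrMr.
have gS r : r < g -> 0 <= r -> exists2 w, V w & r * rdot w w < rdot (G w) w.
  move=> rg r0; apply: contrapT => hno; have : g <= r.
    apply: ge_inf; first by case: S0.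
    split => // w Vw; rewrite leNgt; apply/negP => hw; apply: hno; by exists w.
  by rewrite leNgt rg.
suff gL : lam m * g <= 1.
  move=> Vv; apply: le_trans (ler_wpM2l (ltW L0) (gP _ Vv)) _.
  by rewrite mulrA -[leRHS]mul1r ler_wpM2r ?rdot_ge0.
rewrite leNgt; apply/negP => gL.
have g0 : 0 < g by rewrite -(pmulr_rgt0 _ L0); apply: lt_trans gL.
pose B u := ofR k g *: u - G u.
have pB : positive_on V B g.
  split=> [x y|t x|x Vx|x y||x Vx|x Vx]; rewrite /B.
  - by rewrite (form_invD hpd) scalerDr opprD addrACA.
  - by rewrite (form_invZ hpd) (scalerBr t) !scalerA (mulrC t).
  - apply: (subspaceB Vs); [exact: (subspaceZ Vs)|exact: orthocompl_eigen_stable].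
  - by rewrite !rdotE (rdot_form_inv_sym hpd).
  - exact: ltW.
  - by rewrite !rdotE subr_ge0 gP.
  - rewrite !rdotE gerBl (rdot_form_inv_hr hpd) (hr_ge0 hpd)//; exact: form_inv_dom.
(* At a resolvent point [1 / g], [B] would be bounded below, but it is small at vectors nearly
   attaining [g]. *)
have spec : spectrum setT T (ofR k g^-1).
  move=> /(resolvent_bounded_below hpd)[|c c0 hc]; first by rewrite invr_gt0.
  (* Small enough for [g * e < c], and at most [g] so that [g - e] is nonnegative. *)
  pose e := Num.min g (c / (2 * g)).
  have e0 : 0 < e by rewrite lt_min g0 divr_gt0// mulr_gt0.
  have [||w Vw hw] := gS (g - e); first by rewrite gtrBl.
    by rewrite subr_ge0 ge_min lexx.
  have w0 : 0 < rdot w w.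
    rewrite lt_def rdot_ge0 andbT; apply: contraTneq hw => w0.
    by rewrite w0 mulr0 -leNgt (rdot_eq0 w0) rdot0r.
  have h1 := pos_sqr_le Vs pB Vw.
  have h2 : rdot (B w) w <= e * rdot w w by rewrite /B !rdotE; move: hw; lra.
  have h3 : c * rdot w w <= rdot (B w) (B w).
    apply: le_trans (hc w) _; rewrite invrK /B -(opprB _ (G w)) rdotNl rdotNr opprK//.
  have : c <= g * e.
    rewrite -(ler_pM2r w0); apply: le_trans h3 _; apply: le_trans h1 _.
    by rewrite -mulrA ler_pM2l.
  apply/negP; rewrite -ltNge; apply: le_lt_trans (_ : g * (c / (2 * g)) < c).
    by rewrite ler_pM2l// ge_min lexx orbT.
  have -> : g * (c / (2 * g)) = c / 2 by field; rewrite gt_eqF.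
  by move: c0; lra.
have gltL : g^-1 < lam m by rewrite -(ltr_pM2r g0) mulVf ?gt_eqF.
have [gE iso] := spectrum_below_lam gltL spec.
have [d d0 hd] := isolated_bounded_below hpd l0 iso.
have gl : g = l^-1 by rewrite -gE invrK.
rewrite -gl in hd.
(* A kernel vector of [B] belongs to [E], hence is orthogonal to itself. *)
have kerB w : V w -> B w = 0 -> w = 0.
  move=> Vw /eqP; rewrite subr_eq0 => /eqP Bw.
  have Ew : E w.
    apply/(eigenspaceP hpd); rewrite -Bw gl scalerA -ofRM divff ?ofR1 ?scale1r//.
    by rewrite gt_eqF.
  by apply: rdot_eq0; rewrite /rdot Vw ?reK0.
have gap := pos_gap Vs pB d0 hd erefl kerB.
(* [pos_gap] lowers the upper bound [g] of [G] by [d / 4]; the maximum with [0] is there because [S]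
   has only nonnegative members. *)
have : g <= Num.max (g - d / 4) 0.
  apply: ge_inf; first by case: S0.
  split; first by rewrite le_max lexx orbT.
  move=> w Vw; have := gap w Vw; rewrite /B !rdotE => h1.
  apply: le_trans (_ : (g - d / 4) * rdot w w <= _); first by move: h1; lra.
  by rewrite ler_wpM2r ?rdot_ge0// le_max lexx.
by rewrite leNgt gt_max g0 gtrBl divr_gt0.
Qed.

End LowestEigenvalues.

(** * The eigenspace and the test subspace *)

Lemma underdetermined (F : fieldType) (p n : nat) (A : 'M[F]_(p, n)) : (n < p)%N ->
  exists2 c : 'rV_p, c != 0 & c *m A = 0.
Proof.
move=> np; have : kermx A != 0.
  by rewrite -mxrank_eq0 mxrank_ker subn_eq0 -ltnNge (leq_ltn_trans (rank_leq_col A)).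
case/rowV0Pn => c cA c0; exists c => //; exact/sub_kermxP.
Qed.

Section LinearAlgebra.
Variables (R : realType) (k : scalar_kind) (H : hilbertType R k).
Local Notation K := (scalars R k).
Local Notation "''[' u , v ]" := (inner H u v).

Lemma innerB_eq0 (u e x : H) : '[u - e, x] = 0 -> rdot u x = rdot e x.
Proof.
by move=> /(congr1 (@reK R k)); rewrite innerDl innerNl reKB reK0 => /subr0_eq.
Qed.

Lemma has_dim_subspace (S : set H) n : has_dim S n -> subspace S.
Proof.
move=> [b _ ->]; split.
  by exists (fun=> 0); rewrite big1// => i _; rewrite scale0r.
move=> a _ _ [c ->] [d ->]; exists (fun i => a * c i + d i).
rewrite scaler_sumr -big_split/=; apply: eq_bigr => i _.
by rewrite scalerDl scalerA.
Qed.

Lemma lin_indep_row n (b : 'I_n -> H) (c : 'rV[K]_n) : lin_indep b ->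
  \sum_i c ord0 i *: b i = 0 -> c = 0.
Proof. by move=> bf /bf h; apply/rowP => i; rewrite h mxE. Qed.

(** These are [n] linear equations in [p > n] coordinates. *)
Lemma has_dim_orthogonal (S : set H) p n (w : 'I_n -> H) :
  has_dim S p -> (n < p)%N -> exists u, [/\ S u, u != 0 & forall j, '[u, w j] = 0].
Proof.
move=> [b bf ->] np.
have [c c0 cA] := underdetermined (\matrix_(i, j) '[b i, w j] : 'M[K]_(p, n)) np.
exists (\sum_i c ord0 i *: b i); split; first by exists (fun i => c ord0 i).
  by apply: contra c0 => /eqP/(lin_indep_row bf) ->.
move=> j; rewrite inner_suml; have := congr1 (fun M : 'rV_n => M ord0 j) cA.
by rewrite !mxE => cAj; rewrite -[RHS]cAj; apply: eq_bigr => i _; rewrite innerZl mxE.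
Qed.

(** Nondegeneracy makes the matrix of inner products between bases of [S] and [S'] invertible, and
    [u] solves a square linear system. *)
Lemma has_dim_dual (S S' : set H) n (e : H) : has_dim S n -> has_dim S' n ->
  (forall u, S u -> (forall x, S' x -> '[u, x] = 0) -> u = 0) ->
  exists2 u, S u & forall x, S' x -> '[u - e, x] = 0.
Proof.
move=> [b bf ->] [b' bf' ->] nondeg.
pose A : 'M[K]_n := \matrix_(i, j) '[b i, b' j].
have Aunit : A \in unitmx.
  rewrite -row_free_unit; apply: inj_row_free => c cA; apply: (lin_indep_row bf).
  apply: nondeg; first by exists (fun i => c ord0 i).
  move=> _ [d ->]; rewrite inner_sumr big1// => j _; rewrite innerZr inner_suml.
  have := congr1 (fun M : 'rV_n => M ord0 j) cA; rewrite !mxE => cAj.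
  rewrite [X in _ * X](_ : _ = 0) ?mulr0// -[RHS]cAj.
  by apply: eq_bigr => i _; rewrite innerZl mxE.
pose t : 'rV[K]_n := \row_j '[e, b' j].
pose c := t *m invmx A.
exists (\sum_i c ord0 i *: b i); first by exists (fun i => c ord0 i).
move=> _ [d ->]; rewrite inner_sumr big1// => j _; rewrite innerZr innerDl innerNl.
have S1 : '[\sum_i c ord0 i *: b i, b' j] = '[e, b' j].
  have := congr1 (fun M : 'rV_n => M ord0 j) (mulmxKV Aunit t).
  rewrite [RHS]mxE => <-; rewrite inner_suml mxE.
  by apply: eq_bigr => i _; rewrite innerZl [A i j]mxE.
by rewrite S1 subrr mulr0.
Qed.

Lemma has_dim_surj (S S' : set H) n (L : {linear H -> H}) : has_dim S n -> has_dim S' n ->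
  (forall u, S u -> S' (L u)) -> (forall u, S u -> L u = 0 -> u = 0) ->
  forall y, S' y -> exists2 x, S x & L x = y.
Proof.
move=> [b bf SE] [b' bf' S'E] LS Linj.
have Sb i : S (b i).
  rewrite SE; exists (fun j => (j == i)%:R); rewrite (bigD1 i)//= eqxx scale1r.
  by rewrite big1 ?addr0// => j /negPf ->; rewrite scale0r.
have : forall i, exists c : 'I_n -> K, L (b i) = \sum_j c j *: b' j.
  by move=> i; have := LS _ (Sb i); rewrite S'E.
move=> /choice[a aE]; pose A : 'M[K]_n := \matrix_(i, j) a i j.
have LE (c : 'rV[K]_n) : L (\sum_i c ord0 i *: b i) = \sum_j (c *m A) ord0 j *: b' j.
  rewrite linear_sum; under [RHS]eq_bigr do rewrite mxE scaler_suml.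
  rewrite exchange_big/=; apply: eq_bigr => i _; rewrite linearZ/= aE scaler_sumr.
  by apply: eq_bigr => j _; rewrite scalerA mxE.
have Aunit : A \in unitmx.
  rewrite -row_free_unit; apply: inj_row_free => c cA; apply: (lin_indep_row bf).
  apply: Linj; first by rewrite SE; exists (fun i => c ord0 i).
  by rewrite LE cA big1// => j _; rewrite mxE scale0r.
move=> y; rewrite S'E => -[d ->].
pose c := (\row_j d j) *m invmx A.
exists (\sum_i c ord0 i *: b i); first by rewrite SE; exists (fun i => c ord0 i).
by rewrite LE mulmxKV//; apply: eq_bigr => j _; rewrite mxE.
Qed.

End LinearAlgebra.

(** * Form bounds relative to the eigenspace, and its projection on the test subspace *)

Section Lowest.
Variables (R : realType) (k : scalar_kind) (H : hilbertType R k).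
Variables (h : form H) (hpd : posdef_form h).
Local Notation K := (scalars R k).
Local Notation Q := (fdom h).
Local Notation "''[' u , v ]" := (inner H u v).
Local Notation T := (form_op setT h).
Local Notation G := (form_inv h).
Let Qsub : subspace Q := fdom_subspace hpd.

Variables (m : nat) (m_gt0 : (0 < m)%N) (lam : nat -> R).
Hypotheses (lamE : lowest_eigenvalues T m.+1 lam) (lam1m : lam 0%N = lam m.-1).
Local Notation l := (lam 0%N).
Local Notation L := (lam m).
Local Notation E := (eigenspace T (ofR k l)).
Let l0 : 0 < l := lam_gt0 hpd lamE.
Let Esub : subspace E := eigenspace_subspace hpd _.

Lemma eigen_dom e : E e -> Q e. Proof. by case. Qed.

Lemma hr_eigen e v : E e -> Q v -> hr h e v = l * rdot e v.
Proof. by case=> _ _ he Qv; rewrite /hr he// innerZl reK_ofRM. Qed.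

(** Dual to [spectral_gap]: by Cauchy-Schwarz, [|v|^4 = h(G v, v)^2 <= (G v, v) h[v]]. *)
Lemma form_gap v : Q v -> orthocompl E v -> L * rdot v v <= hr h v v.
Proof.
move=> Qv Vv; have g1 := spectral_gap hpd m_gt0 lamE lam1m Vv.
have L0 : 0 < L := lt_le_trans l0 (lam_le lamE).
have [->|n0] := eqVneq (rdot v v) 0; first by rewrite mulr0 (hr_ge0 hpd).
have v0 : 0 < rdot v v by rewrite lt_def n0 rdot_ge0.
have := hr_CS hpd (form_inv_dom hpd v) Qv.
rewrite (hr_form_inv hpd)// -(rdot_form_inv_hr hpd) => h2.
rewrite -(ler_pM2l v0) mulrCA -expr2.
apply: le_trans (ler_wpM2l (ltW L0) h2) _.
by rewrite mulrA ler_wpM2r// (hr_ge0 hpd).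
Qed.

(** The eigenspace is closed: [1 - l G] is symmetric and annihilates [E], hence also the limit [p]
    of vectors of [E]. *)
Lemma eigen_projection u : exists2 e, E e & orthocompl E (u - e).
Proof.
have [p [pcl hp]] := projection_exists Esub u; exists p => //.
apply/(eigenspaceP hpd)/rdot_ext => w; apply/eqP; rewrite -subr_eq0 -rdotNl -rdotDl.
have -> : rdot (p - ofR k l *: G p) w = rdot p (w - ofR k l *: G w).
  by rewrite !rdotE (rdot_form_inv_sym hpd).
apply/eqP; apply: (rdot_closure_eq0 pcl) => e /(eigenspaceP hpd) Ee.
rewrite !rdotE -(rdot_form_inv_sym hpd) -[X in _ - X]rdotZl -Ee.
by rewrite subrr.
Qed.

(** Pythagoras: since [h(e, .) = l (e, .)], orthogonality to [e] is also orthogonality for [h]. *)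
Lemma hr_split u e : Q u -> E e -> orthocompl E (u - e) ->
  hr h u u = l * rdot e e + hr h (u - e) (u - e) /\
  rdot u u = rdot e e + rdot (u - e) (u - e).
Proof.
move=> Qu Ee ue; have Qe := eigen_dom Ee.
have due : rdot e u = rdot e e by rewrite rdotC; exact/innerB_eq0/ue.
split; last by rewrite !rdotE (rdotC u e) due; ring.
rewrite (hrB_expand hpd)// (hrC hpd Qu Qe) (hr_eigen Ee Qu) (hr_eigen Ee Qe) due; ring.
Qed.

Lemma form_ge u : Q u -> l * rdot u u <= hr h u u.
Proof.
move=> Qu; have [e Ee ue] := eigen_projection u.
have [-> ->] := hr_split Qu Ee ue; rewrite mulrDr lerD2l.
have Que : Q (u - e) by have := eigen_dom Ee => ?; in_subspace.
apply: le_trans (form_gap Que ue); rewrite ler_wpM2r ?rdot_ge0//.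
exact: (lam_le lamE).
Qed.

Lemma form_inv_le_lam u : l * rdot (G u) u <= rdot u u.
Proof. exact: (form_inv_le hpd (ltW l0) form_ge). Qed.

Lemma eigen_has_dim : l < L -> has_dim E m.
Proof.
move=> lL; have [_ [d d0 hd]] := lowest_discrete hpd lamE.
case: lamE => _ _ /(_ l d hd)[_ /(_ (ex_intro2 _ _ m (ltnSn m) lL)) md].
(* [m] is counted as the number of indices other than the last; these are the ones carrying the
   value [l]. *)
rewrite -[X in has_dim _ X]/(m.+1.-1) -[X in X.-1]card_ord -(cardsC1 (@ord_max m)).
suff -> : [set~ ord_max]%SET = [set i : 'I_m.+1 | lam i == l]%SET by rewrite md.
apply/setP => i; rewrite !inE; have [im|] := ltnP i m.
  rewrite (lam_eq m_gt0 lamE lam1m im) eqxx; apply/eqP => /(congr1 val)/= iE.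
  by rewrite iE ltnn in im.
move=> mi; have -> : i = ord_max.
  by apply/val_inj/eqP; rewrite /= eqn_leq mi -ltnS ltn_ord.
by rewrite eqxx gt_eqF.
Qed.

Variables (P : {linear H -> H}).
Hypothesis P_test : test_subspace h P m.

Lemma proj_inner u v : '[P u, v] = '[u, P v].
Proof. by case: P_test => -[_ + _ _]; apply. Qed.

Lemma projK u : P (P u) = P u.
Proof. by case: P_test => -[+ _ _ _]; apply. Qed.

Lemma range_projE u : range P u -> P u = u.
Proof. by case=> x _ <-; exact: projK. Qed.

Lemma proj_dom u : Q (P u).
Proof. by case: P_test => _ _; apply; exists u. Qed.

Lemma rdot_proj u v : rdot (P u) v = rdot u (P v).
Proof. by rewrite /rdot proj_inner. Qed.

Lemma orthocompl_proj u : orthocompl (range P) (u - P u).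
Proof. by move=> _ [x _ <-]; rewrite -proj_inner linearB/= projK subrr inner0l. Qed.

Lemma orthocompl_proj0 v : orthocompl (range P) v -> P v = 0.
Proof.
move=> Pv; apply: rdot_ext => w; rewrite rdot_proj rdot0l /rdot Pv ?reK0//.
Qed.

Lemma range_dim : has_dim (range P) m. Proof. by case: P_test. Qed.

Variable M : R.
Hypotheses (ML : M < L) (hM : forall u, range P u -> hr h u u <= M * rdot u u).

Lemma lam_lt : l < L.
Proof.
have [u Pu u0] := has_dim_neq0 m_gt0 range_dim.
apply: le_lt_trans ML; rewrite -(ler_pM2r (rdot_gt0 u0)).
apply: le_trans (hM Pu); apply: form_ge; rewrite -(range_projE Pu); exact: proj_dom.
Qed.

(* [e] is the projection on [E] of some [u] in the range of [P], and
   [|e|^2 = (P e, u)]; the bound on [h[u]] prevents [e] from being small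
   compared to [u]. *)
Lemma proj_eigen_ge e : E e -> (L - M) * rdot e e <= (L - l) * rdot (P e) (P e).
Proof.
move=> Ee; have lL := lam_lt; have Em := eigen_has_dim lL.
(* A nonzero [u] in the range orthogonal to [E] would satisfy both [h[u] >= L |u|^2] and [h[u] <= M
   |u|^2]. *)
have [|u Pu ue] := has_dim_dual e range_dim Em.
  move=> u Pu uE; have Qu : Q u by rewrite -(range_projE Pu); exact: proj_dom.
  have := le_trans (form_gap Qu uE) (hM Pu).
  rewrite -subr_le0 -mulrBl pmulr_rle0 ?subr_gt0// => u0.
  by apply: rdot_eq0; apply/eqP; rewrite eq_le u0 rdot_ge0.
have Qu : Q u by rewrite -(range_projE Pu); exact: proj_dom.
have Que : Q (u - e) by have := eigen_dom Ee => ?; in_subspace.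
have [h1 h2] := hr_split Qu Ee ue.
have h3 := form_gap Que ue; have h4 := hM Pu.
have h5 : (L - M) * rdot u u <= (L - l) * rdot e e by move: h1 h3 h4; rewrite h2; lra.
have h6 : rdot (P e) u = rdot e e.
  by rewrite rdot_proj (range_projE Pu) rdotC; exact/innerB_eq0/ue.
have h7 := rdot_CS (P e) u; rewrite h6 in h7.
have [->|n0] := eqVneq (rdot e e) 0.
  by rewrite mulr0 mulr_ge0 ?rdot_ge0// subr_ge0 ltW.
have e0 : 0 < rdot e e by rewrite lt_def n0 rdot_ge0.
rewrite -(ler_pM2r e0) -mulrA -expr2.
have LM : 0 <= L - M by rewrite subr_ge0 ltW.
apply: le_trans (ler_wpM2l LM h7) _.
rewrite mulrCA [leRHS](_ : _ = rdot (P e) (P e) * ((L - l) * rdot e e)); last by ring.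
by rewrite ler_wpM2l ?rdot_ge0.
Qed.

(** [proj_eigen_ge] makes [P] injective on [E], and the dimensions agree. *)
Lemma proj_eigen_surj y : range P y -> exists2 e, E e & P e = y.
Proof.
move=> Py; apply: (has_dim_surj (eigen_has_dim lam_lt) range_dim) Py => [u _|e Ee Pe0].
  by exists u.
have := proj_eigen_ge Ee; rewrite Pe0 rdot0l mulr0 pmulr_rle0 ?subr_gt0// => e0.
by apply: rdot_eq0; apply/eqP; rewrite eq_le e0 rdot_ge0.
Qed.

(** Let [e] be the projection of [v] on [E]. As [P v = 0], [|e|^2 = (e - P e, v)]; with
    [proj_eigen_ge] this gives [(L - l) |e|^2 <= (M - l) |v|^2], to be inserted in [h[v] >= L |v|^2
    - (L - l) |e|^2]. It keeps the spectrum of [W] away from [l]. *)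
Lemma form_compl_ge v : Q v -> orthocompl (range P) v ->
  (l + (L - M)) * rdot v v <= hr h v v.
Proof.
move=> Qv Pv; have [e Ee ve] := eigen_projection v.
have [h1 h2] := hr_split Qv Ee ve.
have Qve : Q (v - e) by have := eigen_dom Ee => ?; in_subspace.
have h3 := form_gap Qve ve; have h4 := proj_eigen_ge Ee.
have Pe_v : rdot (P e) v = 0 by rewrite rdotC /rdot Pv ?reK0//; exists e.
have h5 : rdot (e - P e) v = rdot e e.
  by rewrite rdotDl rdotNl Pe_v subr0 rdotC; exact/innerB_eq0/ve.
have := rdot_CS (e - P e) v; rewrite h5.
have -> : rdot (e - P e) (e - P e) = rdot e e - rdot (P e) (P e).
  by rewrite !rdotE (rdot_proj e e) -[in rdot e (P e)]projK -rdot_proj; ring.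
move=> h6; have lL := lam_lt.
suff : (L - l) * rdot e e <= (M - l) * rdot v v by move: h1 h3; rewrite h2; lra.
have [->|n0] := eqVneq (rdot e e) 0.
  rewrite mulr0 mulr_ge0 ?rdot_ge0// subr_ge0.
  have [u Pu u0] := has_dim_neq0 m_gt0 range_dim.
  rewrite -(ler_pM2r (rdot_gt0 u0)); apply: le_trans (hM Pu).
  apply: form_ge; rewrite -(range_projE Pu); exact: proj_dom.
have e0 : 0 < rdot e e by rewrite lt_def n0 rdot_ge0.
rewrite -(ler_pM2r e0) -mulrA -expr2.
have Ll : 0 <= L - l by rewrite subr_ge0 ltW.
apply: le_trans (ler_wpM2l Ll h6) _.
rewrite mulrA [leRHS]mulrAC ler_wpM2r ?rdot_ge0//; move: h4; lra.
Qed.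

End Lowest.

(** * The Rayleigh quotient and its eigenbasis *)

Section Orthonormal.
Variables (R : realType) (k : scalar_kind) (H : hilbertType R k).
Local Notation K := (scalars R k).
Local Notation "''[' u , v ]" := (inner H u v).

Definition nrm2 (c : K) : R := reK (c * conjK R k c).

Lemma nrm2_ge0 c : 0 <= nrm2 c.
Proof. by rewrite -(ler_ofR k) ofR0 /nrm2 mul_conjK -ge0_ofRE exprn_ge0. Qed.

Lemma nrm2_ofRM (t : R) c : nrm2 (ofR k t * c) = t ^+ 2 * nrm2 c.
Proof. by rewrite /nrm2 rmorphM conj_ofR mulrACA -ofRM -expr2 reK_ofRM. Qed.

Variables (n : nat) (f : 'I_n -> H) (f_on : orthonormal_fam f).

Lemma inner_onb_l (a : 'I_n -> K) i : '[\sum_j a j *: f j, f i] = a i.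
Proof.
rewrite inner_suml (bigD1 i)//= innerZl f_on eqxx mulr1 big1 ?addr0// => j ji.
by rewrite innerZl f_on (negPf ji) mulr0.
Qed.

Lemma inner_onb (a b : 'I_n -> K) :
  '[\sum_i a i *: f i, \sum_i b i *: f i] = \sum_i a i * conjK R k (b i).
Proof.
rewrite inner_sumr; apply: eq_bigr => i _.
by rewrite innerZr inner_onb_l mulrC.
Qed.

Lemma rdot_onb (a : 'I_n -> K) (t : 'I_n -> R) :
  rdot (\sum_i (ofR k (t i) * a i) *: f i) (\sum_i a i *: f i) = \sum_i t i * nrm2 (a i).
Proof.
rewrite /rdot inner_onb reK_sum; apply: eq_bigr => i _.
by rewrite -mulrA reK_ofRM.
Qed.

Lemma rdot_onb1 (a : 'I_n -> K) :
  rdot (\sum_i a i *: f i) (\sum_i a i *: f i) = \sum_i nrm2 (a i).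
Proof. by rewrite /rdot inner_onb reK_sum. Qed.

Lemma orthonormal_lin_indep : lin_indep f.
Proof. by move=> c c0 i; rewrite -(inner_onb_l c i) c0 inner0l. Qed.

Definition onb_span : set H := [set u | exists c : 'I_n -> K, u = \sum_i c i *: f i].

Lemma onb_span_dim : has_dim onb_span n.
Proof. by exists f => //; exact: orthonormal_lin_indep. Qed.

Lemma onb_spanE u : onb_span u -> u = \sum_i '[u, f i] *: f i.
Proof. by case=> c ->; apply: eq_bigr => i _; rewrite inner_onb_l. Qed.

Lemma bessel u : \sum_i nrm2 '[u, f i] <= rdot u u.
Proof.
pose p := \sum_i '[u, f i] *: f i.
have up : rdot u p = \sum_i nrm2 '[u, f i].
  rewrite /rdot inner_sumr reK_sum; apply: eq_bigr => i _.
  by rewrite innerZr mulrC.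
have := rdot_ge0 (u - p); rewrite !rdotE (rdotC p u) up -/(rdot p p).
by rewrite [rdot p p]rdot_onb1; lra.
Qed.

End Orthonormal.

(** * The square root and the form *)

Section SquareRoot.
Variables (R : realType) (k : scalar_kind) (H : hilbertType R k).
Variables (h : form H) (hpd : posdef_form h).
Variables (S : operator H) (SE : is_sqrt (form_op setT h) S).
Local Notation K := (scalars R k).
Local Notation Q := (fdom h).
Local Notation "''[' u , v ]" := (inner H u v).
Local Notation T := (form_op setT h).
Local Notation G := (form_inv h).
Let Qsub : subspace Q := fdom_subspace hpd.

Lemma sqrt_sym u w u' w' : S u w -> S u' w' -> '[w', u] = '[u', w].
Proof. by case: SE => -[_ Sadj] _ _ /Sadj[_ hu]; exact: hu. Qed.

Lemma sqrt_adjoint u w : (forall u' w', S u' w' -> '[w', u] = '[u', w]) -> S u w.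
Proof. by case: SE => -[_ Sadj] _ _ hu; apply/Sadj; split. Qed.

Lemma sqrt_scale (c : K) u w : S u w -> S (c *: u) (c *: w).
Proof.
by move=> Su; apply: sqrt_adjoint => u' w' Su'; rewrite !innerZr (sqrt_sym Su Su').
Qed.

(** The second representation theorem. [u] is the limit for [h] of vectors [G (f n)], the images
    [S (G (f n))] form a Cauchy sequence, and [S] is closed since it equals its adjoint. *)
Lemma sqrt_form u : Q u ->
  exists2 a, S u a & forall v b, Q v -> S v b -> h u v = '[a, b].
Proof.
move=> Qu.
have /choice[s sP] : forall f, exists v, S (G f) v /\ S v f.
  move=> f; have := form_invP hpd f; case: SE => _ _ TE /TE[v S1 S2].
  by exists v.
have /choice[f fP] : forall n : nat, exists f, hr h (G f - u) (G f - u) < n.+1%:R^-1.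
  move=> n; have n0 : 0 < n.+1%:R^-1 :> R by rewrite invr_gt0 ltr0n.
  by have [f hf] := form_inv_range_dense hpd Qu n0; exists f.
have QG := form_inv_dom hpd.
(* Symmetry of [S], since [s x = S (G x)] and [S (s x) = x]. *)
have ss x y : '[s x, s y] = '[x, G y].
  by have [S1 _] := sP y; have [_ S2] := sP x; rewrite (sqrt_sym S1 S2).
have ssB x y : rdot (s x - s y) (s x - s y) = hr h (G x - G y) (G x - G y).
  have rss z t : rdot (s z) (s t) = rdot z (G t) by rewrite /rdot ss.
  rewrite -(form_invB hpd) -(rdot_form_inv_hr hpd) (form_invB hpd) !rdotE !rss.
  by rewrite !(rdotC (G _)); ring.
have [a sa] : exists a : H, (fun n => s (f n)) @ \oo --> a.
  apply: hilbert_complete => e e0; have [N hN] := natr_inv_lt (divr_gt0 e0 (ltr0n R 4)).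
  exists N => i j Ni Nj; rewrite ssB.
  have hi := lt_trans (fP i) (hN i Ni); have hj := lt_trans (fP j) (hN j Nj).
  have Qi : Q (G (f i) - u) by have := QG (f i) => ?; in_subspace.
  have Qj : Q (G (f j) - u) by have := QG (f j) => ?; in_subspace.
  have -> : G (f i) - G (f j) = (G (f i) - u) - (G (f j) - u).
    by rewrite opprB addrA subrK.
  have Qij : Q (G (f i) - u + ofR k 1 *: (G (f j) - u)) by in_subspace.
  have := hr_ge0 hpd Qij; rewrite (hr_expand hpd _ Qi Qj) (hrB_expand hpd Qi Qj).
  by move: hi hj; lra.
have approx e : 0 < e -> exists g, [/\ hr h (G g - u) (G g - u) < e,
    rdot (G g - u) (G g - u) < e & rdot (s g - a) (s g - a) < e].
  move=> e0; have [c c0 hc] := hr_lower_bound hpd.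
  have [N1 hN1] := natr_inv_lt e0; have [N2 hN2] := natr_inv_lt (mulr_gt0 c0 e0).
  move/cvg_rdotP : sa => /(_ e e0)[N3 hN3].
  pose n := maxn N1 (maxn N2 N3); exists (f n); split.
  - by apply: lt_trans (fP n) (hN1 _ _); rewrite leq_maxl.
  - rewrite -(ltr_pM2l c0); apply: le_lt_trans (hc _ _) _.
      by have := QG (f n) => ?; in_subspace.
    by apply: lt_trans (fP n) (hN2 _ _); rewrite !leq_max leqnn orbT.
  - by apply: hN3; rewrite !leq_max leqnn !orbT.
exists a.
  have real_eq u' w' : S u' w' -> rdot w' u = rdot u' a.
    move=> Su'; apply/eqP; rewrite -subr_eq0 -sqrf_eq0 eq_le sqr_ge0 andbT.
    apply: (@le0_eps _ _ (2 * (rdot w' w' + rdot u' u'))) => e e0.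
    have [g [_ g1 g2]] := approx e e0.
    have E1 : rdot w' (G g) = rdot u' (s g).
      by have [S1 _] := sP g; rewrite /rdot (sqrt_sym S1 Su').
    have -> : rdot w' u - rdot u' a = rdot u' (s g - a) - rdot w' (G g - u).
      by rewrite !rdotE E1; ring.
    have c1 := rdot_CS u' (s g - a); have c2 := rdot_CS w' (G g - u).
    have c3 := ler_wpM2l (rdot_ge0 u') (ltW g2).
    have c4 := ler_wpM2l (rdot_ge0 w') (ltW g1).
    move: c1 c2 c3 c4 (sqr_ge0 (rdot u' (s g - a) + rdot w' (G g - u))).
    by rewrite sqrrD sqrrB; lra.
  apply: sqrt_adjoint => u' w' Su'; apply/eqP; rewrite -subr_eq0; apply/eqP.
  apply: reK_conjM0; rewrite mulrBr -!innerZl reKB -/(rdot _ _) -/(rdot _ _).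
  by rewrite (real_eq _ _ (sqrt_scale _ Su')) subrr.
move=> v b Qv Sv.
(* Real parts suffice: scaling [v] and [b] by a common scalar recovers the full identity. *)
suff heq (v' b' : H) : Q v' -> S v' b' -> hr h u v' = rdot a b'.
  apply/eqP; rewrite -subr_eq0; apply/eqP; apply: reK_conjM0.
  set c := conjK _ _ (h u v - _); have := heq (conjK R k c *: v) (conjK R k c *: b).
  rewrite /rdot innerZr /hr (form_symmetric hpd)//; last by in_subspace.
  rewrite (formZl hpd)// rmorphM -(form_symmetric hpd)// conj_conjK => heq'.
  rewrite mulrBr reKB heq' ?subrr//; [by in_subspace|exact: sqrt_scale].
move=> Qv' Sv'; apply/eqP; rewrite -subr_eq0 -sqrf_eq0 eq_le sqr_ge0 andbT.
apply: (@le0_eps _ _ (2 * (hr h v' v' + rdot b' b'))) => e e0.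
have [g [g0 _ g2]] := approx e e0.
have E1 : hr h (G g) v' = rdot (s g) b'.
  by rewrite (hr_form_inv hpd)//; have [_ S2] := sP g; rewrite /rdot (sqrt_sym Sv' S2).
have QGg := QG g; have QGu : Q (G g - u) by in_subspace.
have -> : hr h u v' - rdot a b' = rdot (s g - a) b' - hr h (G g - u) v'.
  by rewrite (hrBl hpd)// !rdotE E1; ring.
have c1 := rdot_CS (s g - a) b'; have c2 := hr_CS hpd QGu Qv'.
have c3 := ler_wpM2r (rdot_ge0 b') (ltW g2).
have c4 := ler_wpM2r (hr_ge0 hpd Qv') (ltW g0).
move: c1 c2 c3 c4 (sqr_ge0 (rdot (s g - a) b' + hr h (G g - u) v')).
by rewrite sqrrD sqrrB; lra.
Qed.

Variables (m : nat) (P : {linear H -> H}) (P_test : test_subspace h P m).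

(** Eliminates the square root: the Rayleigh quotient is the operator of [h] restricted to the range
    of [P]. *)
Lemma rayleighP u x : rayleigh S P u x <->
  [/\ range P u, range P x & forall v, range P v -> h u v = '[x, v]].
Proof.
have PE := range_projE P_test.
have PQ v : range P v -> Q v by move=> /PE <-; exact: (proj_dom P_test).
split=> [[v [Pu Sv] [Px hx]]|[Pu Px hx]].
  split => // u' Pu'; have [a Sa ha] := sqrt_form (PQ _ Pu').
  rewrite (PE _ Pu) in Sv.
  rewrite (form_symmetric hpd) ?(ha _ _ (PQ _ Pu) Sv)//; try exact: PQ.
  rewrite (hx u' a) -?innerC//; split => //; by rewrite PE.
have [a Sa ha] := sqrt_form (PQ _ Pu).
exists a; first by split => //; rewrite PE.
split => // u' w' [Pu' Sw']; rewrite PE// in Sw'.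
by rewrite innerC -(ha _ _ (PQ _ Pu') Sw') hx// -innerC.
Qed.

End SquareRoot.

(** * Ritz vectors and the inverses of the Rayleigh quotient and of [H_P] *)

Section RitzBasis.
Variables (R : realType) (k : scalar_kind) (H : hilbertType R k).
Variables (h : form H) (hpd : posdef_form h).
Variables (S : operator H) (SE : is_sqrt (form_op setT h) S).
Local Notation K := (scalars R k).
Local Notation Q := (fdom h).
Local Notation "''[' u , v ]" := (inner H u v).
Let Qsub : subspace Q := fdom_subspace hpd.
Variables (m : nat) (P : {linear H -> H}) (P_test : test_subspace h P m).
Variables (mu : nat -> R) (muE : all_eigenvalues (rayleigh S P) m mu).

Lemma rayleigh_eigen_orth u v (a b : R) : rayleigh S P u (ofR k a *: u) ->
  rayleigh S P v (ofR k b *: v) -> a != b -> '[u, v] = 0.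
Proof.
move=> /(rayleighP hpd SE P_test)[Pu _ hu] /(rayleighP hpd SE P_test)[Pv _ hv] ab.
have Qu : Q u by rewrite -(range_projE P_test Pu); exact: (proj_dom P_test).
have Qv : Q v by rewrite -(range_projE P_test Pv); exact: (proj_dom P_test).
have : ofR k (a - b) * '[u, v] = 0.
  rewrite ofRD ofRN mulrDl mulNr -!innerZl -hu// innerZl.
  rewrite (form_symmetric hpd)// hv// innerZl rmorphM conj_ofR -innerC subrr//.
move=> /eqP; rewrite mulf_eq0 => /orP[|/eqP//].
by rewrite -(ofR0 R k) => /eqP/ofR_inj/eqP; rewrite subr_eq0 (negPf ab).
Qed.

Lemma rayleigh_scale (c : K) u x : rayleigh S P u x -> rayleigh S P (c *: u) (c *: x).
Proof.
move=> /(rayleighP hpd SE P_test)[Pu Px hu]; apply/(rayleighP hpd SE P_test).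
have Rs := has_dim_subspace (range_dim P_test).
split; try exact: subspaceZ.
have PQ v : range P v -> Q v.
  by move=> Pv; rewrite -(range_projE P_test Pv); exact: (proj_dom P_test).
by move=> v Pv; rewrite (formZl hpd) ?hu ?innerZl//; exact: PQ.
Qed.

(** By induction, the next vector is taken in the eigenspace of [mu n], orthogonal to those already
    chosen there; vectors for other Ritz values are orthogonal to it by symmetry. *)
Lemma ritz_family n : (n <= m)%N -> exists f : nat -> H,
  (forall i j, (i < n)%N -> (j < n)%N -> '[f i, f j] = (i == j)%:R) /\
  forall i, (i < n)%N -> rayleigh S P (f i) (ofR k (mu i) *: f i).
Proof.
elim: n => [_|n IH nm]; first by exists (fun=> 0).
have [f [fon fray]] := IH (ltnW nm).
have [_ /(_ (mu n)) Edim] := muE.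
(* Earlier indices with the same Ritz value; [n] itself is missing, so they are fewer than the
   dimension of the eigenspace. *)
pose A := [set i : 'I_m | (i < n)%N && (mu i == mu n)]%SET.
have [|u [Eu u0 uf]] := has_dim_orthogonal (fun j : 'I_#|A| => f (enum_val j)) Edim.
  apply: proper_card; apply/properP; split.
    by apply/fintype.subsetP => i; rewrite !inE => /andP[].
  by exists (Ordinal nm); rewrite !inE ?eqxx// ltnn.
pose g := ofR k (Num.sqrt (rdot u u))^-1 *: u.
have Rg : rayleigh S P g (ofR k (mu n) *: g).
  by rewrite scalerA mulrC -scalerA; exact: rayleigh_scale.
have gg : '[g, g] = 1.
  rewrite inner_selfE rdotZl rdotZr mulrA -expr2 exprVn sqr_sqrtr ?rdot_ge0//.
  by rewrite mulVf ?ofR1// gt_eqF// rdot_gt0.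
have gf i : (i < n)%N -> '[g, f i] = 0.
  move=> ni; have [mui|mui] := eqVneq (mu i) (mu n).
    have iA : Ordinal (ltn_trans ni nm) \in A by rewrite inE/= ni mui eqxx.
    have := uf (enum_rank_in iA (Ordinal (ltn_trans ni nm))).
    by rewrite enum_rankK_in//= innerZl => ->; rewrite mulr0.
  by apply: rayleigh_eigen_orth Rg (fray i ni) _; rewrite eq_sym.
exists (fun i => if (i < n)%N then f i else g); split.
  move=> i j; rewrite (ltnS i) (ltnS j) (leq_eqVlt i) (leq_eqVlt j).
  case: (ltnP i n) => [ni _|ni /[!orbF]/eqP iE];
  case: (ltnP j n) => [nj _|nj /[!orbF]/eqP jE].
  - exact: fon.
  - by rewrite innerC gf// rmorph0 jE; case: eqVneq ni => // ->; rewrite ltnn.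
  - by rewrite gf// iE; case: eqVneq nj => // <-; rewrite ltnn.
  - by rewrite iE jE eqxx gg.
move=> i; rewrite ltnS leq_eqVlt; case: ltnP => [ni _|ni].
  exact: fray.
by rewrite orbF => /eqP ->.
Qed.

Lemma ritz_basis : exists f : 'I_m -> H, orthonormal_fam f /\
  forall i, rayleigh S P (f i) (ofR k (mu i) *: f i).
Proof.
have [f [fon fray]] := ritz_family (leqnn m).
by exists (fun i => f i); split => [i j|i]; [rewrite fon|exact: fray].
Qed.

Variables (f : 'I_m -> H) (f_on : orthonormal_fam f).
Hypothesis f_ray : forall i, rayleigh S P (f i) (ofR k (mu i) *: f i).

Lemma ritz_range i : range P (f i).
Proof. by have /(rayleighP hpd SE P_test)[] := f_ray i. Qed.

Lemma range_dom u : range P u -> Q u.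
Proof. by move=> Pu; rewrite -(range_projE P_test Pu); exact: (proj_dom P_test). Qed.

Lemma ritz_sum_range (c : 'I_m -> K) : range P (\sum_i c i *: f i).
Proof.
have Rs := has_dim_subspace (range_dim P_test).
by apply: (subspace_sum Rs) => i _; apply: (subspaceZ Rs); exact: ritz_range.
Qed.

Lemma range_ritzE u : range P u -> u = \sum_i '[u, f i] *: f i.
Proof.
move=> Pu; apply: onb_spanE => //.
have [|//|x Sx <-//] := has_dim_surj (L := (idfun : {linear H -> H})) (onb_span_dim f_on)
  (range_dim P_test) _ _ Pu.
by move=> _ [c ->]; exact: ritz_sum_range.
Qed.

Lemma form_ritz (c : 'I_m -> K) v : range P v ->
  h (\sum_i c i *: f i) v = '[\sum_(i < m) (ofR k (mu i) * c i) *: f i, v].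
Proof.
move=> Pv; have Qv := range_dom Pv; have Qf i := range_dom (ritz_range i).
suff [] : Q (\sum_i c i *: f i) /\
    h (\sum_i c i *: f i) v = '[\sum_(i < m) (ofR k (mu i) * c i) *: f i, v] by [].
elim/big_ind2: _ => [|x y x' y' [Qx hx] [Qx' hx']|i _].
- by split; [exact: Qsub.1|rewrite (form0l hpd)// inner0l].
- by split; [in_subspace|rewrite (formDl hpd)// innerDl hx hx'].
have Qfi := Qf i; split; first by in_subspace.
have /(rayleighP hpd SE P_test)[_ _ hf] := f_ray i.
by rewrite (formZl hpd)// hf// !innerZl mulrCA mulrA.
Qed.

Lemma hr_ritz (c : 'I_m -> K) :
  hr h (\sum_i c i *: f i) (\sum_i c i *: f i) = \sum_(i < m) mu i * nrm2 (c i).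
Proof.
rewrite /hr form_ritz; last exact: ritz_sum_range.
exact: (rdot_onb f_on c (fun i : 'I_m => mu i)).
Qed.

Lemma hr_ritz1 i : hr h (f i) (f i) = mu i.
Proof.
have /(rayleighP hpd SE P_test)[_ _ hf] := f_ray i.
rewrite /hr hf; last exact: ritz_range.
by rewrite innerZl f_on eqxx mulr1 ofRK.
Qed.

Lemma rdot_ritz1 i : rdot (f i) (f i) = 1.
Proof. by rewrite /rdot f_on eqxx -(ofR1 R k) ofRK. Qed.

Lemma hr_range_le u : range P u -> hr h u u <= mu m.-1 * rdot u u.
Proof.
move=> Pu; rewrite (range_ritzE Pu) hr_ritz rdot_onb1// mulr_sumr.
apply: ler_sum => i _; rewrite ler_wpM2r ?nrm2_ge0//.
have [mono _] := muE; apply: mono.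
have m0 : (0 < m)%N := leq_ltn_trans (leq0n i) (ltn_ord i).
by rewrite -ltnS prednK// ltn_ord leqnn.
Qed.

Lemma mu_gt0 (i : 'I_m) : 0 < mu i.
Proof.
rewrite -hr_ritz1; have [c c0 hc] := hr_lower_bound hpd.
apply: lt_le_trans (hc _ (range_dom (ritz_range i))).
by rewrite rdot_ritz1 mulr1.
Qed.

(** The inverse of the Rayleigh quotient, diagonal in the Ritz basis. *)
Definition ritz_inv u := \sum_(i < m) (ofR k (mu i)^-1 * '[u, f i]) *: f i.

Lemma ritz_invP psi v : range P psi -> range P v -> h (ritz_inv psi) v = '[psi, v].
Proof.
move=> Ppsi Pv; rewrite form_ritz//; congr (inner H _ _); rewrite [RHS]range_ritzE//.
apply: eq_bigr => i _; rewrite mulrA -ofRM mulfV ?ofR1 ?mul1r//.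
by rewrite gt_eqF// mu_gt0.
Qed.

Lemma ritz_inv_range psi : range P (ritz_inv psi).
Proof. exact: ritz_sum_range. Qed.

Lemma op_inv_rayleigh psi : range P psi -> op_inv (rayleigh S P) psi = ritz_inv psi.
Proof.
move=> Ppsi; have Ry : rayleigh S P (ritz_inv psi) psi.
  apply/(rayleighP hpd SE P_test); split => //; first exact: ritz_inv_range.
  by move=> v; exact: ritz_invP.
have Rs := has_dim_subspace (range_dim P_test).
rewrite /op_inv; case: xgetP => [u _ /(rayleighP hpd SE P_test)[Pu _ hu]|/(_ _ Ry)//].
have Qu := range_dom Pu; have Qy := range_dom (ritz_inv_range psi).
have Py := ritz_inv_range psi.
apply/eqP; rewrite -subr_eq0; apply/eqP; apply: (hr_eq0 hpd).
  by in_subspace.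
have Pd : range P (u - ritz_inv psi) by in_subspace.
rewrite (hrBl hpd)//; last by in_subspace.
by rewrite /hr hu// ritz_invP// subrr.
Qed.

Lemma op_inv_HP psi : range P psi ->
  op_inv (form_op setT (form_HP h P)) psi = ritz_inv psi.
Proof.
move=> Ppsi; set y := ritz_inv psi.
have Py : range P y by exact: ritz_inv_range.
have PyE := range_projE P_test Py.
have Qy := range_dom Py.
have QP u : Q (P u) := proj_dom P_test u.
have Ty : form_op setT (form_HP h P) y psi.
  split => // v Qv /=; have QPv := QP v; rewrite PyE subrr.
  rewrite (form0l hpd); last exact: (subspaceB Qsub).
  rewrite addr0 (ritz_invP Ppsi (imageP P (I : setT v))).
  by rewrite -(proj_inner P_test) (range_projE P_test Ppsi).
rewrite /op_inv; case: xgetP => [u _ [/= Qu _ hu]|/(_ _ Ty)//].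
have [_ _ /= hy] := Ty.
pose d := u - y; have Qd : Q d by rewrite /d; in_subspace.
have QPd := QP d; have Qd2 : Q (d - P d) by in_subspace.
have QPu := QP u; have Qu2 : Q (u - P u) by in_subspace.
have QPy := QP y; have Qy2 : Q (y - P y) by in_subspace.
(* The difference [d] of two solutions satisfies [h_P[d] = 0], a sum of two nonnegative terms. *)
have : hr h (P d) (P d) + hr h (d - P d) (d - P d) = 0.
  have {1}-> : P d = P u - P y by rewrite /d linearB.
  have {1}-> : d - P d = (u - P u) - (y - P y).
    by rewrite /d linearB/= !opprB addrACA [in RHS]addrACA; congr (_ + _); rewrite addrC.
  rewrite (hrBl hpd QPu QPy QPd) (hrBl hpd Qu2 Qy2 Qd2) addrACA -opprD.
  by rewrite /hr -!reKD hu// hy// subrr.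
move=> /eqP; rewrite paddr_eq0 ?(hr_ge0 hpd)// => /andP[/eqP h1 /eqP h2].
have P0 : P d = 0 by apply: (hr_eq0 hpd) => //; rewrite h1.
have : d - P d = 0 by apply: (hr_eq0 hpd) => //; rewrite h2.
by rewrite P0 subr0 => /eqP; rewrite subr_eq0 => /eqP.
Qed.

Lemma rdot_ritz_inv psi :
  rdot psi (ritz_inv psi) = \sum_(i < m) (mu i)^-1 * nrm2 '[psi, f i].
Proof.
rewrite /rdot /ritz_inv inner_sumr reK_sum; apply: eq_bigr => i _.
by rewrite innerZr rmorphM conj_ofR -mulrA reK_ofRM [_ * '[_, _]]mulrC.
Qed.

End RitzBasis.

(** * The spectrum of W *)

Section Gap.
Variables (R : realType) (k : scalar_kind) (H : hilbertType R k).
Hypothesis H_infdim : infinite_dim H.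
Variables (h : form H) (hpd : posdef_form h).
Local Notation K := (scalars R k).
Local Notation Q := (fdom h).
Local Notation "''[' u , v ]" := (inner H u v).
Local Notation G := (form_inv h).
Let Qsub : subspace Q := fdom_subspace hpd.
Variables (m : nat) (P : {linear H -> H}) (P_test : test_subspace h P m).

Lemma dense_rdot (D : set H) u : dense D ->
  forall e : R, 0 < e -> exists2 v, D v & rdot (v - u) (v - u) < e.
Proof.
move=> Dd e e0; have se : 0 < Num.sqrt e by rewrite sqrtr_gt0.
have [||v [uv Dv]] := Dd (ball u (ofR k (Num.sqrt e))).
- by exists u; apply: ballxx; rewrite -(ofR0 R k) ltr_ofR.
- exact: ball_open.
exists v => //; move: uv; rewrite -ball_normE /ball_/= ltr_normr_rdot//.
by rewrite sqr_sqrtr ?(ltW e0)// -opprB rdotNl rdotNr opprK.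
Qed.

Local Notation M := (orthocompl (range P)).
Local Notation D := (Q `&` M).

Lemma compl_subspace : subspace D.
Proof.
have Ms : subspace M := orthocompl_subspace _.
split; first by split; [exact: Qsub.1|exact: Ms.1].
by move=> a u v [Qu Mu] [Qv Mv]; split; [exact: Qsub.2|exact: Ms.2].
Qed.

(** With [r] a basis of the range of [P], take [u] orthogonal to all [G (r j)]: then [G u] is in the
    form domain and orthogonal to the range. *)
Lemma compl_neq0 : exists2 v, D v & v != 0.
Proof.
have [b bf] := H_infdim m.+1; have [r _ rE] := range_dim P_test.
have bdim : has_dim [set u | exists c : 'I_m.+1 -> K, u = \sum_i c i *: b i] m.+1.
  by exists b.
have [u [_ u0 ur]] := has_dim_orthogonal (fun j => G (r j)) bdim (ltnSn m).
exists (G u).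
  split; first exact: (form_inv_dom hpd).
  move=> v; rewrite rE => -[c ->]; rewrite inner_sumr big1// => j _.
  by rewrite innerZr (form_inv_sym hpd) ur mulr0.
apply: contra u0 => /eqP Gu0; apply/eqP/rdot_eq0.
apply: (rdot_closure_eq0 (dense_rdot u (fdom_dense hpd))) => v Qv.
by rewrite rdotC -(hr_form_inv hpd)// Gu0 /hr (form0l hpd)// reK0.
Qed.

Lemma form_WE u v : D u -> D v -> form_W h P u v = h u v.
Proof. by move=> [_ Mu] [_ Mv] /=; rewrite !(orthocompl_proj0 P_test)// !subr0. Qed.

Variables (l d : R) (l0 : 0 < l) (d0 : 0 < d).
Hypothesis compl_ge : forall v, D v -> (l + d) * rdot v v <= hr h v v.

(** On the complement [h - x] is coercive with constant [l + d - x], whose inverse bounds the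
    resolvent. *)
Lemma W_resolvent (x : R) : x < l + d -> resolvent_set M (op_W h P) (ofR k x).
Proof.
move=> xd; have Ds := compl_subspace; have DQ : D `<=` Q by move=> ? [].
have c0 : 0 < l + d - x by rewrite subr_gt0.
have coercive v : D v -> (l + d - x) * rdot v v <= hr h v v - x * rdot v v.
  by move=> /compl_ge; rewrite mulrBl lerD2r.
exists (ofR k (l + d - x)^-1) => w Mw.
have [u [Qu ucl hu]] := shifted_form_solve hpd w Ds DQ c0 coercive.
have Du : D u by split => //; apply: orthocompl_closed ucl _ => ? [].
have hu' v : D v -> h u v = '[w + ofR k x *: u, v].
  apply: (hr_all_eq0 hpd) => // v' Dv'; rewrite rdotDl rdotZl -(hu v' Dv').
  by rewrite subrK.
have Mu : M u by case: Du.
exists u; split.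
- have Ms : subspace M := orthocompl_subspace _.
  split => //; first by apply: (subspaceD Ms) => //; exact: (subspaceZ Ms).
  by move=> v Dv; rewrite form_WE// hu'.
- rewrite !normr_rdot -ofRM ler_ofR ler_pdivlMl//.
  have := coercive u Du; rewrite hu// => h1.
  have h2 := rdot_CS w u.
  rewrite -ler_sqr ?nnegrE ?mulr_ge0 ?sqrtr_ge0 ?(ltW c0)//.
  rewrite exprMn !sqr_sqrtr ?rdot_ge0//.
  have [->|n0] := eqVneq (rdot u u) 0; first by rewrite mulr0 rdot_ge0.
  have u0 : 0 < rdot u u by rewrite lt_def n0 rdot_ge0.
  rewrite -(ler_pM2r u0) -mulrA -expr2 -exprMn; apply: le_trans h2.
  have cu : 0 <= (l + d - x) * rdot u u by rewrite mulr_ge0 ?(ltW c0) ?rdot_ge0.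
  by rewrite ler_sqr ?nnegrE//; exact: le_trans h1.
move=> v [Dv _ hv]; apply/eqP; rewrite -subr_eq0; apply/eqP.
have Dvu : D (v - u) by in_subspace.
have Qv : Q v by case: Dv.
have Qvu : Q (v - u) by case: Dvu.
apply: rdot_eq0; apply/eqP; rewrite eq_le rdot_ge0 andbT -(pmulr_rle0 _ c0).
apply: le_trans (coercive _ Dvu) _; rewrite (hrBl hpd)//.
have -> : hr h v (v - u) = rdot (w + ofR k x *: v) (v - u).
  by rewrite /hr -form_WE// hv.
have -> : hr h u (v - u) = rdot (w + ofR k x *: u) (v - u) by rewrite /hr hu'.
rewrite -rdotNl -rdotDl -rdotZl -rdotNl -rdotDl.
have -> : w + ofR k x *: v - (w + ofR k x *: u) - ofR k x *: (v - u) = 0.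
  by apply: rdot_ext => z; rewrite !rdotE rdot0l; ring.
by rewrite rdot0l.
Qed.

(** Take for [w] the greatest lower bound of the form on the complement; a bounded resolvent at [w]
    would allow a larger one. *)
Lemma W_bottom : exists w : R, [/\ l + d <= w,
  spectrum M (op_W h P) (ofR k w) & forall v, D v -> w * rdot v v <= hr h v v].
Proof.
pose S := [set r : R | forall v, D v -> r * rdot v v <= hr h v v].
have Sd : S (l + d) by [].
have [u Du u0] := compl_neq0; have ru := rdot_gt0 u0.
have Sub : has_ubound S.
  by exists (hr h u u / rdot u u) => r /(_ u Du); rewrite ler_pdivlMr.
exists (sup S); set w := sup S.
have wP v : D v -> w * rdot v v <= hr h v v.
  move=> Dv; have [v0|n0] := eqVneq (rdot v v) 0.
    by have := Sd v Dv; rewrite v0 !mulr0.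
  have rv : 0 < rdot v v by rewrite lt_def n0 rdot_ge0.
  rewrite -ler_pdivlMr//; apply: ge_sup; first by exists (l + d).
  by move=> r /(_ v Dv); rewrite ler_pdivlMr.
split => //; first exact: ub_le_sup.
move=> [C hC].
(* Let [a] be the resolvent applied to [v]. Cauchy-Schwarz for the semidefinite form [h - w] gives
   [|v|^4 <= (v, a) (h[v] - w |v|^2)], and [(v, a) <= c |v|^2]. *)
pose c := reK C; have key v : D v -> rdot v v <= c * (hr h v v - w * rdot v v).
  move=> Dv; have [Qv Mv] := Dv; have [a [[Da _ ha] na _]] := hC v Mv.
  have Qa : Q a by case: Da.
  have ha' z : D z -> hr h a z - w * rdot a z = rdot v z.
    move=> Dz; rewrite /hr -form_WE// ha// -/(rdot _ _) rdotDl rdotZl.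
    by rewrite addrK.
  move: na; rewrite !normr_rdot => /ler_reK; rewrite ofRK mulrC reK_ofRM -/c => na.
  have [->|v0] := eqVneq v 0.
    by rewrite rdot0l !mulr0 /hr (form0l hpd) ?reK0 ?subr0 ?mulr0//; exact: Qsub.1.
  have rv := rdot_gt0 v0.
  have qa : hr h a a - w * rdot a a <= c * rdot v v.
    rewrite ha'//; have [|q0] := leP (rdot v a) 0.
      move=> q0; apply: le_trans q0 _; apply: mulr_ge0; last exact: rdot_ge0.
      by have := le_trans (sqrtr_ge0 _) na; rewrite pmulr_rge0// sqrtr_gt0.
    rewrite -ler_sqr ?nnegrE ?(ltW q0)//; last first.
      rewrite mulr_ge0 ?(ltW rv)//.
      by have := le_trans (sqrtr_ge0 _) na; rewrite pmulr_rge0// sqrtr_gt0.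
    apply: le_trans (rdot_CS _ _) _; rewrite exprMn expr2 [c ^+ 2 * _]mulrC.
    rewrite -mulrA ler_pM2l//.
    rewrite -[leLHS]sqr_sqrtr ?rdot_ge0// -[X in _ <= X * _]sqr_sqrtr ?rdot_ge0// -exprMn.
    by rewrite ler_sqr ?nnegrE ?sqrtr_ge0//; exact: le_trans (sqrtr_ge0 _) na.
  have qv0 : 0 <= hr h v v - w * rdot v v by rewrite subr_ge0 wP.
  have CS : rdot v v ^+ 2 <= (hr h a a - w * rdot a a) * (hr h v v - w * rdot v v).
    apply: quadratic_discr => // t.
    have Dt : D (a + ofR k t *: v) by have Ds := compl_subspace; in_subspace.
    have := wP _ Dt; rewrite (hr_expand hpd _ Qa Qv) !rdotE (rdotC v a) -(ha' v Dv); lra.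
  rewrite -(ler_pM2l rv) -expr2; apply: le_trans CS _.
  by rewrite mulrA (mulrC _ c) ler_wpM2r.
have c0 : 0 < c.
  rewrite ltNge; apply/negP => c0; have := key u Du.
  apply/negP; rewrite -ltNge; apply: le_lt_trans ru.
  by rewrite mulr_le0_ge0// subr_ge0 wP.
suff : w + c^-1 <= w by rewrite gerDl leNgt invr_gt0 c0.
apply: ub_le_sup => // v Dv; rewrite mulrDl -lerBrDl.
by rewrite ler_pdivrMl// key.
Qed.

(** [(x - l) / x] increases with [x]: the lower bound [l + d] of the spectrum gives positivity, and
    its point [w] gives [l <= (1 - g) w], to be combined with [h[v] >= w |v|^2]. *)
Lemma gap1P : [/\ 0 < gap1 h P l, gap1 h P l < 1 & forall v, D v ->
  gap1 h P l * hr h v v <= hr h v v - l * rdot v v].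
Proof.
have [w [wl sw wP]] := W_bottom.
set A := [set _ | x in _]; pose g := gap1 h P l.
have ld : 0 < l + d by rewrite addr_gt0.
have w0 : 0 < w := lt_le_trans ld wl.
have lw : l < w by apply: lt_le_trans wl; rewrite ltrDl.
have gw : g <= (w - l) / w.
  apply: ge_inf; last by exists w => //; rewrite distrC gtr0_norm ?subr_gt0.
  exists 0 => _ [x sx <-].
  have xl : l + d <= x by rewrite leNgt; apply/negP => /W_resolvent.
  by rewrite divr_ge0// (le_trans _ xl)// ltW.
have g0 : d / (l + d) <= g.
  apply: lb_le_inf; first by exists (`|l - w| / w); exists w.
  move=> _ [x sx <-]; have xl : l + d <= x by rewrite leNgt; apply/negP => /W_resolvent.
  have lx : l < x by apply: lt_le_trans xl; rewrite ltrDl.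
  rewrite distrC gtr0_norm ?subr_gt0// ler_pdivrMr// mulrAC.
  rewrite ler_pdivlMr; last exact: lt_trans lx.
  have := ler_wpM2l (ltW l0) xl; lra.
have g1 : 0 < g by apply: lt_le_trans g0; rewrite divr_gt0.
have g_lt1 : g < 1 by apply: le_lt_trans gw _; rewrite ltr_pdivrMr// mul1r gtrBl.
split => // v Dv; have := wP v Dv => h1.
have h2 : l * rdot v v <= (1 - g) * (w * rdot v v).
  rewrite mulrA ler_wpM2r ?rdot_ge0//; move: gw; rewrite ler_pdivlMr//; lra.
have := ler_wpM2l _ h1; move=> /(_ (1 - g)); rewrite subr_ge0 => /(_ (ltW g_lt1)).
by rewrite -/g; move: h2; lra.
Qed.

End Gap.

(** * Bounds for eta *)

Section Eta.
Variables (R : realType) (k : scalar_kind) (H : hilbertType R k).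
Hypothesis H_infdim : infinite_dim H.
Variables (h : form H) (hpd : posdef_form h).
Variables (S : operator H) (SE : is_sqrt (form_op setT h) S).
Local Notation K := (scalars R k).
Local Notation Q := (fdom h).
Local Notation "''[' u , v ]" := (inner H u v).
Local Notation T := (form_op setT h).
Local Notation G := (form_inv h).
Let Qsub : subspace Q := fdom_subspace hpd.
Variables (P : {linear H -> H}) (m : nat) (m_gt0 : (0 < m)%N).
Hypothesis P_test : test_subspace h P m.
Variables (lam : nat -> R) (lamE : lowest_eigenvalues T m.+1 lam).
Variables (mu : nat -> R) (muE : all_eigenvalues (rayleigh S P) m mu).
Hypotheses (mu_lam : mu m.-1 < lam m) (lam1m : lam 0%N = lam m.-1).
Variables (f : 'I_m -> H) (f_on : orthonormal_fam f).
Hypothesis f_ray : forall i, rayleigh S P (f i) (ofR k (mu i) *: f i).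
Local Notation l := (lam 0%N).
Local Notation L := (lam m).
Local Notation g := (gap1 h P l).
Local Notation E := (eigenspace T (ofR k l)).
Local Notation D := (Q `&` orthocompl (range P)).

Let l0 : 0 < l := lam_gt0 hpd lamE.
Let hM u : range P u -> hr h u u <= mu m.-1 * rdot u u.
Proof. exact: (hr_range_le hpd SE P_test muE f_on f_ray). Qed.
Let gP : [/\ 0 < g, g < 1 & forall v, D v -> g * hr h v v <= hr h v v - l * rdot v v].
Proof.
apply: (gap1P H_infdim hpd P_test l0 (d := L - mu m.-1)); first by rewrite subr_gt0.
by move=> v [Qv Pv]; apply: (form_compl_ge hpd m_gt0 lamE lam1m P_test).
Qed.

(* The optimal correction of [phi] would be [- W^-1 P_perp H phi]; moving
   towards the eigenvector [e] above [phi] by the factor [g] is enough. *)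
Lemma trial_vector phi : range P phi -> exists u, [/\ Q u, P u = phi &
  hr h u u <= (1 - g) * hr h phi phi + g * l * rdot phi phi].
Proof.
move=> Pphi; have [g0 g1 gD] := gP.
have [e Ee Pe] := proj_eigen_surj hpd m_gt0 lamE lam1m P_test mu_lam hM Pphi.
have Qe := eigen_dom Ee; have Qphi := range_dom P_test Pphi.
pose v := e - phi; have Qv : Q v by rewrite /v; in_subspace.
have Mv : orthocompl (range P) v by rewrite /v -Pe; exact: (orthocompl_proj P_test).
have gv := gD v (conj Qv Mv).
have e_phi : rdot e phi = rdot phi phi.
  by rewrite -{1}(range_projE P_test Pphi) -(rdot_proj P_test) Pe.
have phi_v : rdot phi v = 0.
  by rewrite rdotC /rdot Mv ?reK0.
have h1 : hr h v v = hr h phi phi - l * rdot phi phi + l * rdot v v.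
  rewrite /v (hrB_expand hpd)// !(hr_eigen Ee)// !rdotE (rdotC phi e) e_phi; ring.
have h2 : hr h phi v = l * rdot phi phi - hr h phi phi.
  by rewrite /v (hrBr hpd)// (hrC hpd Qphi Qe) (hr_eigen Ee)// e_phi.
exists (phi + ofR k g *: v); split; first by in_subspace.
  rewrite linearD linearZ/= (orthocompl_proj0 P_test Mv) scaler0 addr0.
  exact: (range_projE P_test).
(* With [X = h[phi] - l |phi|^2], [h[phi + g v] = h[phi] - 2 g X + g^2 h[v]], while [g h[v] <= h[v]
   - l |v|^2 = X]. *)
rewrite (hr_expand hpd)// h2.
have := ler_wpM2l (ltW g0) gv; rewrite [X in _ <= g * (X - _)]h1; lra.
Qed.

Lemma unit_rdot (psi : H) : `|psi| = 1 -> rdot psi psi = 1.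
Proof.
move=> u; apply: (@ofR_inj _ k); by rewrite -normr_sqrE u expr1n ofR1.
Qed.

Lemma rdot_unit (psi : H) : rdot psi psi = 1 -> `|psi| = 1.
Proof. by rewrite normr_rdot => ->; rewrite sqrtr1 ofR1. Qed.

Local Notation beta i := ((mu i - l) / mu i).

Lemma lam_le_mu (i : 'I_m) : l <= mu i.
Proof.
rewrite -(hr_ritz1 hpd SE P_test f_on f_ray) -[l]mulr1 -(rdot_ritz1 f_on i).
apply: (form_ge hpd m_gt0 lamE lam1m); apply: (range_dom P_test).
exact: (ritz_range hpd SE P_test f_ray).
Qed.

Let mu0 (i : 'I_m) : 0 < mu i := mu_gt0 hpd SE P_test f_on f_ray i.

Lemma beta_ge0 (i : 'I_m) : 0 <= beta i.
Proof. by rewrite divr_ge0 ?subr_ge0 ?lam_le_mu// ltW. Qed.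

Lemma mu_mono (i j : 'I_m) : (i <= j)%N -> mu i <= mu j.
Proof. by have [mono _] := muE => ij; apply: mono; rewrite ij ltn_ord. Qed.

Lemma eta_quotientE psi : range P psi -> eta_quotient h P psi =
  (rdot psi (G psi) - rdot psi (ritz_inv mu f psi)) / rdot psi (G psi).
Proof.
move=> Ppsi; rewrite /eta_quotient reKB.
by rewrite (op_inv_HP hpd SE P_test f_on f_ray Ppsi).
Qed.

(** The trial vector [y = Xi^-1 psi] has [h[y] = (psi, y)]. *)
Lemma ritz_inv_le psi : range P psi ->
  rdot psi (ritz_inv mu f psi) <= rdot psi (G psi).
Proof.
move=> Ppsi; have Py := ritz_inv_range hpd SE P_test f_ray psi.
have := rdot_form_inv_ge hpd psi (range_dom P_test Py).
rewrite [in hr _ _ _]/hr (ritz_invP hpd SE P_test f_on f_ray)// -/(rdot _ _).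
rewrite (rdotC (G psi)); lra.
Qed.

Lemma rdot_form_inv_gt0 psi : range P psi -> psi != 0 -> 0 < rdot psi (G psi).
Proof.
move=> Ppsi psi0; have Qpsi := range_dom P_test Ppsi.
rewrite rdotC (rdot_form_inv_hr hpd) lt_def (hr_ge0 hpd) ?andbT;
  last exact: (form_inv_dom hpd).
apply: contra psi0 => /eqP G0; apply/eqP/rdot_eq0.
have /(hr_eq0 hpd (form_inv_dom hpd psi)) Gpsi : hr h (G psi) (G psi) <= 0 by rewrite G0.
by rewrite -(hr_form_inv hpd)// Gpsi /hr (form0l hpd)// reK0.
Qed.

Lemma eta_quotient_ge0 psi : range P psi -> 0 <= eta_quotient h P psi.
Proof.
move=> Ppsi; rewrite eta_quotientE// divr_ge0 ?subr_ge0 ?ritz_inv_le//.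
by rewrite rdotC (rdot_form_inv_hr hpd) (hr_ge0 hpd)//; exact: (form_inv_dom hpd).
Qed.

Lemma sum_nrm2 psi : range P psi -> \sum_i nrm2 '[psi, f i] = rdot psi psi.
Proof.
move=> Ppsi; rewrite [in RHS](range_ritzE hpd SE P_test f_on f_ray Ppsi).
by rewrite rdot_onb1.
Qed.

(** The quotient is [1 - (psi, Xi^-1 psi) / (psi, G psi)], where [(psi, G psi) <= 1 / l], and
    [(psi, Xi^-1 psi) >= 1 / mu i] as only Ritz values up to [mu i] contribute. *)
Lemma eta_quotient_le (i : 'I_m) psi : range P psi -> rdot psi psi = 1 ->
  (forall j : 'I_m, (i < j)%N -> '[psi, f j] = 0) -> eta_quotient h P psi <= beta i.
Proof.
move=> Ppsi psi1 psi_f.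
have psi0 : psi != 0 by apply: contra_eq_neq psi1 => ->; rewrite rdot0l eq_sym oner_eq0.
have A0 := rdot_form_inv_gt0 Ppsi psi0.
rewrite eta_quotientE// ler_pdivrMr//.
have b_ge : (mu i)^-1 <= rdot psi (ritz_inv mu f psi).
  rewrite rdot_ritz_inv -[leLHS]mulr1 -psi1 -(sum_nrm2 Ppsi) mulr_sumr.
  apply: ler_sum => j _; have [ij|ji] := ltnP i j.
    by rewrite psi_f// /nrm2 mul0r reK0 !mulr0.
  by rewrite ler_wpM2r ?nrm2_ge0// lef_pV2 ?posrE// mu_mono.
have := form_inv_le_lam hpd m_gt0 lamE lam1m psi; rewrite psi1 rdotC => lA.
have lA' : l / mu i * rdot psi (G psi) <= (mu i)^-1.
  by rewrite mulrAC ler_pdivrMr// mulVf// gt_eqF.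
have -> : beta i = 1 - l / mu i by field; rewrite gt_eqF.
by move: b_ge lA'; lra.
Qed.

(** The trial vector above [phi = ((1 - g) Xi + g l)^-1 psi] gives [(psi, G psi) >= (psi, phi)];
    then coefficients are compared in the Ritz basis. *)
Lemma eta_quotient_ge (i : 'I_m) psi : range P psi -> rdot psi psi = 1 ->
  (forall j : 'I_m, (j < i)%N -> '[psi, f j] = 0) -> g * beta i <= eta_quotient h P psi.
Proof.
move=> Ppsi psi1 psi_f; have [g0 g1 _] := gP.
have psi0 : psi != 0 by apply: contra_eq_neq psi1 => ->; rewrite rdot0l eq_sym oner_eq0.
have A0 := rdot_form_inv_gt0 Ppsi psi0.
pose x (j : 'I_m) := (1 - g) * mu j + g * l.
have x0 j : 0 < x j by rewrite addr_gt0// mulr_gt0// subr_gt0.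
pose phi := \sum_j (ofR k (x j)^-1 * '[psi, f j]) *: f j.
have Pphi : range P phi by exact: (ritz_sum_range hpd SE P_test f_ray).
have [u [Qu Pu hu]] := trial_vector Pphi.
have A_ge : \sum_j (x j)^-1 * nrm2 '[psi, f j] <= rdot psi (G psi).
  have := rdot_form_inv_ge hpd psi Qu.
  have -> : rdot psi u = \sum_j (x j)^-1 * nrm2 '[psi, f j].
    rewrite -{1}(range_projE P_test Ppsi) (rdot_proj P_test) Pu rdotC.
    by rewrite {1}(range_ritzE hpd SE P_test f_on f_ray Ppsi) rdotC rdotC rdot_onb.
  have : hr h u u <= \sum_j (x j)^-1 * nrm2 '[psi, f j].
    apply: le_trans hu _; rewrite (hr_ritz hpd SE P_test f_on f_ray) rdot_onb1//.
    rewrite !mulr_sumr -big_split/=; apply: ler_sum => j _.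
    have xx : ((1 - g) * mu j + g * l) * (x j)^-1 = 1 by rewrite mulfV// gt_eqF// x0.
    rewrite !nrm2_ofRM [leLHS](_ : _ = ((1 - g) * mu j + g * l) * (x j)^-1 *
      ((x j)^-1 * nrm2 '[psi, f j])); last by move: (x j)^-1 => y; ring.
    by rewrite xx mul1r.
  rewrite (rdotC (G psi)); lra.
rewrite eta_quotientE// ler_pdivlMr//.
suff : rdot psi (ritz_inv mu f psi) <= (1 - g * beta i) * rdot psi (G psi) by lra.
have gb : 0 <= 1 - g * beta i.
  rewrite subr_ge0 mulr_ile1 ?beta_ge0 ?(ltW g0) ?(ltW g1)//.
  by rewrite ler_pdivrMr// mul1r gerBl ltW.
apply: le_trans (ler_wpM2l gb A_ge); rewrite rdot_ritz_inv mulr_sumr.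
(* [x j = mu j (1 - g beta j)], and [beta j >= beta i] for [j >= i]; for smaller [j] the coefficient
   of [psi] vanishes. *)
apply: ler_sum => j _; have [ji|ij] := ltnP j i.
  by rewrite psi_f// /nrm2 mul0r reK0 !mulr0.
rewrite [leRHS]mulrA ler_wpM2r ?nrm2_ge0// ler_pdivlMr// mulrC ler_pdivrMr// /x.
have : beta i * mu j <= mu j - l.
  rewrite mulrAC ler_pdivrMr//.
  have := ler_wpM2l (ltW l0) (mu_mono ij); lra.
move=> /(ler_wpM2l (ltW g0)); lra.
Qed.

Lemma eta_bounds (i : 'I_m) : g * beta i <= eta h P m i ^+ 2 <= beta i.
Proof.
have [g0 g1 _] := gP.
rewrite /eta; set A := [set inf _ | X in _].
have Rs := has_dim_subspace (range_dim P_test).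
have ubA : ubound A (beta i).
  move=> _ [X [XP Xdim] <-].
  (* Some nonzero vector of [X] is orthogonal to the [m - i - 1] Ritz vectors after [f i]. *)
  have ltm (j : 'I_(m - i.+1)) : (i.+1 + j < m)%N by rewrite -ltn_subRL.
  have [|psi [Xpsi psi0 psi_f]] :=
    has_dim_orthogonal (fun j : 'I_(m - i.+1) => f (Ordinal (ltm j))) Xdim.
    by rewrite ltn_sub2l.
  pose c := ofR k (Num.sqrt (rdot psi psi))^-1.
  have Xc : X (c *: psi) by exact: (subspaceZ (has_dim_subspace Xdim)).
  have c1 : rdot (c *: psi) (c *: psi) = 1.
    rewrite rdotZl rdotZr mulrA -expr2 exprVn sqr_sqrtr ?rdot_ge0//.
    by rewrite mulVf// gt_eqF// rdot_gt0.
  apply: le_trans (_ : eta_quotient h P (c *: psi) <= _).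
    apply: ge_inf; last by exists (c *: psi) => //; split => //; exact: rdot_unit.
    by exists 0 => _ [z [Xz _] <-]; exact/eta_quotient_ge0/XP.
  apply: eta_quotient_le => //; first exact: XP.
  move=> j ij; rewrite innerZl.
  have ji : (j - i.+1 < m - i.+1)%N by rewrite ltn_sub2r// (leq_ltn_trans ij).
  have := psi_f (Ordinal ji); set j' := Ordinal _.
  have -> : j' = j by apply: val_inj; rewrite /= subnKC.
  by move=> ->; rewrite mulr0.
(* For the lower bound, the test space is spanned by the [m - i] Ritz vectors from [f i] on. *)
have ltm (j : 'I_(m - i)) : (i + j < m)%N by rewrite -ltn_subRL.
pose b (j : 'I_(m - i)) := f (Ordinal (ltm j)).
have b_on : orthonormal_fam b.
  by move=> j j'; rewrite f_on -val_eqE/= eqn_add2l.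
have bP : onb_span b `<=` range P.
  move=> _ [c ->]; apply: (subspace_sum Rs) => j _; apply: (subspaceZ Rs).
  exact: (ritz_range hpd SE P_test f_ray).
pose X0 := inf [set eta_quotient h P psi |
                  psi in [set psi | onb_span b psi /\ `|psi| = 1]].
have AX0 : A X0 by exists (onb_span b) => //; split => //; exact: onb_span_dim.
have X0_ge : g * beta i <= X0.
  apply: lb_le_inf.
    have mi : (0 < m - i)%N by rewrite subn_gt0.
    exists (eta_quotient h P (b (Ordinal mi))); exists (b (Ordinal mi)) => //; split.
      exists (fun j => (j == Ordinal mi)%:R); rewrite (bigD1 (Ordinal mi))//= scale1r.
      by rewrite big1 ?addr0// => j /negPf ->; rewrite scale0r.
    by apply: rdot_unit; exact: rdot_ritz1.
  move=> _ [psi [bpsi /unit_rdot psi1] <-]; apply: eta_quotient_ge => //; first exact: bP.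
  move=> j ji; case: bpsi => c ->; rewrite inner_suml big1// => j' _.
  rewrite innerZl f_on; case: eqP => [/(congr1 val)/= E1|_]; last by rewrite mulr0.
  by move: ji; rewrite -E1 ltnNge leq_addr.
have sup_ge : g * beta i <= sup A.
  apply: le_trans X0_ge _; apply: ub_le_sup => //; by exists (beta i).
rewrite sqr_sqrtr; last by rewrite (le_trans _ sup_ge)// mulr_ge0 ?beta_ge0// ltW.
by rewrite sup_ge/=; apply: ge_sup => //; exists X0.
Qed.

End Eta.

(** * Unitary invariant norms *)

Section DiagonalOperators.
Variables (R : realType) (k : scalar_kind) (H : hilbertType R k).
Local Notation K := (scalars R k).
Local Notation "''[' u , v ]" := (inner H u v).

Lemma bounded_opP (A : H -> H) (C : R) : linear A -> 0 < C ->
  (forall u, rdot (A u) (A u) <= C ^+ 2 * rdot u u) ->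
  bounded_op A /\ 0 <= opnorm A <= C.
Proof.
move=> Alin C0 hA.
have A0 : A 0 = 0.
  by have := Alin (-1) 0 0; rewrite scaler0 add0r scaleN1r addNr.
have AB u v : A (u - v) = A u - A v.
  by have := Alin (-1) v u; rewrite !scaleN1r (addrC _ u) (addrC _ (A u)).
have nA u : reK `|A u| <= C * reK `|u|.
  rewrite !normr_rdot !ofRK -ler_sqr ?nnegrE ?mulr_ge0 ?sqrtr_ge0 ?(ltW C0)//.
  by rewrite exprMn !sqr_sqrtr ?rdot_ge0.
split.
  split => // u; apply/cvgrPdist_lt => e e0; rewrite (ge0_ofRE (ltW e0)).
  have e0' : 0 < reK e by rewrite -(ltr_ofR k) ofR0 -ge0_ofRE// ltW.
  have eC : 0 < reK e / C by rewrite divr_gt0.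
  apply/nbhs_ballP; exists (ofR k (reK e / C)).
    by rewrite /= -(ofR0 R k) ltr_ofR.
  move=> v; rewrite -ball_normE /ball_/= !ltr_normr_rdot// -AB => uv.
  apply: le_lt_trans (hA _) _.
  rewrite -[reK e](divfK (lt0r_neq0 C0)) exprMn mulrC ltr_pM2r ?exprn_gt0//.
have ub : ubound [set reK `|A u| | u in [set u : H | `|u| <= 1]] C.
  move=> _ [u /= u1 <-]; apply: le_trans (nA u) _.
  rewrite -[leRHS]mulr1 ler_pM2l//; move/ler_reK: u1.
  by have -> : reK (1 : K) = 1 :> R by rewrite -(ofR1 R k) ofRK.
have mem0 : [set reK `|A u| | u in [set u : H | `|u| <= 1]] (0 : R).
  by exists 0; rewrite /= ?A0 ?normr0 ?reK0// ler01.
apply/andP; split; first by apply: ub_le_sup => //; exists C.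
by apply: ge_sup => //; exists 0.
Qed.

Variables (n : nat).

(** Two families are allowed, so that for orthonormal ones [t = 1] gives the partial isometry from
    the span of [f] to that of [e]. *)
Definition diag_op (f e : 'I_n -> H) (t : 'I_n -> R) : H -> H :=
  fun u => \sum_i (ofR k (t i) * '[u, f i]) *: e i.

Lemma diag_op_linear f e t : linear (diag_op f e t).
Proof.
move=> a u v; rewrite /diag_op scaler_sumr -big_split/=; apply: eq_bigr => i _.
by rewrite innerDl innerZl mulrDr scalerDl mulrCA scalerA.
Qed.

Lemma diag_op_comp e1 e2 e3 t s : orthonormal_fam e2 ->
  diag_op e2 e3 t \o diag_op e1 e2 s = diag_op e1 e3 (fun i => t i * s i).
Proof.
move=> on2; apply/funext => u /=; rewrite /diag_op; apply: eq_bigr => i _.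
by rewrite inner_onb_l// mulrA -ofRM.
Qed.

Lemma diag_op_bounded f e t (C : R) : orthonormal_fam f -> orthonormal_fam e ->
  0 < C -> (forall i, `|t i| <= C) ->
  bounded_op (diag_op f e t) /\ 0 <= opnorm (diag_op f e t) <= C.
Proof.
move=> f_on e_on C0 tC; apply: bounded_opP => // [|u]; first exact: diag_op_linear.
rewrite rdot_onb1//.
apply: le_trans (_ : C ^+ 2 * \sum_i nrm2 '[u, f i] <= _); last first.
  by rewrite ler_wpM2l ?sqr_ge0// bessel.
rewrite mulr_sumr; apply: ler_sum => i _; rewrite nrm2_ofRM ler_wpM2r ?nrm2_ge0//.
by rewrite -real_normK ?num_real// ler_sqr ?nnegrE// ltW.
Qed.

(** The rank depends on which [t i] vanish; this is avoided by multiplying the projection on the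
    span of [f], of rank [n], by a bounded operator. *)
Lemma diag_op_ideal (N : unitary_inv_norm H) f t : orthonormal_fam f ->
  ui_ideal N (diag_op f f t).
Proof.
move=> f_on.
have [C C0 tC] : exists2 C : R, 0 < C & forall i, `|t i| <= C.
  exists (1 + \sum_i `|t i|); first by rewrite ltr_pwDl// sumr_ge0.
  by move=> i; rewrite (bigD1 i)//= addrCA lerDl addr_ge0// sumr_ge0.
have [bt _] := diag_op_bounded f_on f_on C0 tC.
have [b1 _] := diag_op_bounded (t := fun=> 1) f_on f_on ltr01
  (fun=> eq_ind_r (fun x => x <= 1) (lexx 1) (normr1 R)).
have I1 : ui_ideal N (diag_op f f (fun=> 1)).
  apply: (@ui_finite_rank _ _ _ N n); split => //.
  suff -> : range (diag_op f f (fun=> 1)) = onb_span f by exact: onb_span_dim.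
  have oneE u : diag_op f f (fun=> 1) u = \sum_i '[u, f i] *: f i.
    by apply: eq_bigr => i _; rewrite ofR1 mul1r.
  apply/seteqP; split=> u.
    by case=> v _ <-; rewrite oneE; exists (fun i => '[v, f i]).
  by move=> fu; exists u => //; rewrite oneE -onb_spanE.
have := ui_mul bt I1 b1; rewrite !diag_op_comp//.
by congr (ui_ideal N (diag_op _ _ _)); apply/funext => i; rewrite !mulr1.
Qed.

(** Write [a = t b]: [diag_op e e a] is [diag_op f f b] preceded by the partial isometry from [e] to
    [f] and followed by [diag_op f e t], of norm at most [C]. Unrelated [e] and [f] cover the
    arbitrary family used for matrices. *)
Lemma diag_op_norm_le (N : unitary_inv_norm H) e f (a b : 'I_n -> R) (C : R) :
  orthonormal_fam e -> orthonormal_fam f -> 0 < C ->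
  (forall i, 0 <= a i <= C * b i) -> (forall i, 0 <= b i) ->
  N (diag_op e e a) <= C * N (diag_op f f b).
Proof.
move=> e_on f_on C0 aCb b0.
(* Where [b i = 0], division by zero yields [t i = 0], and the hypothesis forces [a i = 0]. *)
pose t i := a i / b i.
have tC i : `|t i| <= C.
  have /andP[a0 ab] := aCb i; rewrite ger0_norm ?divr_ge0//.
  have [bi0|bi0] := eqVneq (b i) 0; first by rewrite /t bi0 invr0 mulr0 ltW.
  by rewrite ler_pdivrMr// lt_def bi0 b0.
have tb i : t i * b i = a i.
  have [bi0|bi0] := eqVneq (b i) 0; last by rewrite divfK.
  have := aCb i; rewrite bi0 !mulr0 => ai0; apply/eqP.
  by rewrite eq_sym eq_le andbC.
have [bX /andP[X0 X1]] := diag_op_bounded f_on e_on C0 tC.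
have [bY /andP[Y0 Y1]] := diag_op_bounded (t := fun=> 1) e_on f_on ltr01
  (fun=> eq_ind_r (fun x => x <= 1) (lexx 1) (normr1 R)).
have bI := diag_op_ideal N b f_on.
have := ui_norm_mul bX bI bY; rewrite !diag_op_comp//.
have -> : (fun i => t i * b i * 1) = a by apply/funext => i; rewrite mulr1.
move=> h; apply: le_trans h _; have N0 := ui_ge0 bI.
rewrite -[leRHS]mulr1 ler_pM//; first exact: mulr_ge0.
by rewrite ler_wpM2r.
Qed.

Lemma mx_op_diag (e : 'I_n -> H) (t : 'I_n -> R) :
  mx_op e (diag_mx (\row_i ofR k (t i))) = diag_op e e t.
Proof.
apply/funext => u; rewrite /mx_op /diag_op; apply: eq_bigr => i _; congr (_ *: _).
rewrite (bigD1 i)//= !mxE eqxx mulr1n big1 ?addr0// => j ji.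
by rewrite !mxE eq_sym (negPf ji) mulr0n mul0r.
Qed.

End DiagonalOperators.

Theorem theorem3p4 (R : realType) (k : scalar_kind) (H : hilbertType R k)
  (H_infdim : infinite_dim H)
  (h : form H) (h_posdef : posdef_form h)
  (Hhalf : operator H) (HhalfE : is_sqrt (form_op setT h) Hhalf)
  (P : {linear H -> H}) (m : nat) (m_gt0 : (0 < m)%N)
  (P_test : test_subspace h P m)
  (lam : nat -> R) (lamE : lowest_eigenvalues (form_op setT h) m.+1 lam)
  (mu : nat -> R) (muE : all_eigenvalues (rayleigh Hhalf P) m mu)
  (mu_lam : mu m.-1 < lam m) (lam1m : lam 0%N = lam m.-1) :
  (forall (N : unitary_inv_norm H) (e : 'I_m -> H), orthonormal_fam e ->
     N (mx_op e (diag_eta2 h P m)) <= N (rayleigh_defect Hhalf P (lam 0%N)) /\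
     N (rayleigh_defect Hhalf P (lam 0%N)) <=
       (gap1 h P (lam 0%N))^-1 * N (mx_op e (diag_eta2 h P m))) /\
  \sum_(i < m) eta h P m i ^+ 2 <= \sum_(i < m) (mu i - lam i) / mu i /\
  \sum_(i < m) (mu i - lam i) / mu i <=
    (gap1 h P (lam 0%N))^-1 * \sum_(i < m) eta h P m i ^+ 2.
Proof.
have [f [f_on f_ray]] := ritz_basis h_posdef HhalfE P_test muE.
have eb (i : 'I_m) := eta_bounds H_infdim h_posdef HhalfE m_gt0 P_test lamE muE
  mu_lam lam1m f_on f_ray i.
set l := lam 0%N; set g := gap1 h P l.
have g0 : 0 < g.
  have [||//] := gap1P H_infdim h_posdef P_test (lam_gt0 h_posdef lamE)
    (d := lam m - mu m.-1).
    by rewrite subr_gt0.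
  move=> v [Qv Pv]; apply: (form_compl_ge h_posdef m_gt0 lamE lam1m P_test) => //.
  exact: (hr_range_le h_posdef HhalfE P_test muE f_on f_ray).
pose a (i : 'I_m) := eta h P m i ^+ 2; pose b (i : 'I_m) := (mu i - l) / mu i.
have a0 i : 0 <= a i by exact: sqr_ge0.
have ab i : a i <= b i by have /andP[] := eb i.
have ba i : b i <= g^-1 * a i.
  by have /andP[+ _] := eb i; rewrite -/(a i) -/(b i) ler_pdivlMl.
have b0 i : 0 <= b i := le_trans (a0 i) (ab i).
split.
  move=> N e e_on.
  have -> : mx_op e (diag_eta2 h P m) = diag_op e e a by exact: mx_op_diag.
  (* The defect is diagonal in the Ritz basis, where [u] and [P u] have the same coefficients. *)
  have -> : rayleigh_defect Hhalf P l = diag_op f f b.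
    apply/funext => u; rewrite /rayleigh_defect.
    have Pu : range P (P u) by exists u.
    rewrite (op_inv_rayleigh h_posdef HhalfE P_test f_on f_ray Pu).
    rewrite {1}(range_ritzE h_posdef HhalfE P_test f_on f_ray Pu) /ritz_inv.
    rewrite scaler_sumr -sumrB; apply: eq_bigr => i _.
    have Pf := ritz_range h_posdef HhalfE P_test f_ray i.
    rewrite (proj_inner P_test) (range_projE P_test Pf).
    rewrite scalerA -scalerBl mulrA -ofRM; congr (_ *: _).
    rewrite -{1}[inner H u (f i)]mul1r -mulrBl -(ofR1 R k) -ofRN -ofRD.
    congr (ofR k _ * _); rewrite /b; field.
    by rewrite gt_eqF// (mu_gt0 h_posdef HhalfE P_test f_on f_ray).
  split; last by apply: diag_op_norm_le => // [|i]; rewrite ?invr_gt0// b0 ba.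
  by rewrite -[leRHS]mul1r; apply: diag_op_norm_le => // i; rewrite a0 mul1r ab.
have -> : \sum_(i < m) (mu i - lam i) / mu i = \sum_i b i.
  by apply: eq_bigr => i _; rewrite (lam_eq m_gt0 lamE lam1m (ltn_ord i)).
split; first by apply: ler_sum => i _; exact: ab.
by rewrite mulr_sumr; apply: ler_sum => i _; exact: ba.
Qed.
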